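(* Let $\mathcal{H}$ be a finite-dimensional Hilbert space, let $G_1,\ldots,G_J$ be Hermitian operators on $\mathcal{H}$, and for $\theta\in\mathbb{R}^J$ let $G(\theta)=\sum_{j=1}^J\theta_j G_j$ and $\rho(\theta)=e^{-G(\theta)}/\operatorname{Tr}[e^{-G(\theta)}]$. Then for each $j\in\{1,\ldots,J\}$ the symmetric logarithmic derivative operator of $\rho(\theta)$ with respect to $\theta_j$ is $$L^{(j)}(\theta)=-\Phi_\theta(G_j)+\operatorname{Tr}[G_j\rho(\theta)]\,I,$$ where $I$ is the identity operator on $\mathcal{H}$.
   Context: The ''high-peak tent'' probability density on $\mathbb{R}$ is $p(t)=\frac{2}{\pi}\ln|\coth(\pi t/2)|$. The quantum channel $\Phi_\theta$ is defined on operators $X$ on $\mathcal{H}$ by $\Phi_\theta(X)=\int_{\mathbb{R}}dt\,p(t)\,e^{-iG(\theta)t}Xe^{iG(\theta)t}$. With spectral decomposition $\rho(\theta)=\sum_k\lambda_k|k\rangle\langle k|$, the symmetric logarithmic derivative (SLD) operator is $L^{(j)}(\theta)=\sum_{k,\ell}\frac{2}{\lambda_k+\lambda_\ell}|k\rangle\langle k|\partial_j\rho(\theta)|\ell\rangle\langle\ell|$, where $\partial_j=\partial/\partial\theta_j$. *)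

(* Defs.v *)
From HB Require Import structures.
From mathcomp Require Import all_boot all_order all_algebra.
From mathcomp Require Import all_classical all_reals all_analysis.
From mathcomp Require Export complex.
Import Order.TTheory GRing.Theory Num.Theory.
Import numFieldTopology.Exports numFieldNormedType.Exports.

Set Implicit Arguments.
Unset Strict Implicit.
Unset Printing Implicit Defensive.

Local Open Scope classical_set_scope.
Local Open Scope ring_scope.

(* The complex numbers R[i] carry the (Euclidean) metric topology coming from
   their norm as a numClosedFieldType (this is the generic instance of
   mathcomp-analysis for numeric fields, transported to the head symbol R[i]). *)
Definition cnum (R : rcfType) : numClosedFieldType := R[i].
HB.instance Definition _ (R : rcfType) := PseudoPointedMetric.copy R[i] (cnum R).

Section QDefs.
Variable R : realType.
Local Notation C := R[i].

Definition cR (x : R) : C := Complex x 0.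
Definition iC : C := Complex 0 1.

Definition ctr (m p : nat) (A : 'M[C]_(m, p)) : 'M[C]_(p, m) :=
  map_mx (@conjc R) A^T.

Definition is_herm (n : nat) (A : 'M[C]_n) : Prop := ctr A = A.

Definition mexp (n : nat) (A : 'M[C]_n) : 'M[C]_n :=
  \matrix_(a, b)
    lim ((fun N : nat => (\sum_(k < N) (k`!%:R)^-1 *: A ^+ k) a b) @ \oo).

Definition cderiv (f : R -> C) (t : R) : C :=
  lim ((fun h : R => (f (t + h) - f t) / cR h) @ (0 : R)^').

Definition cintegral (f : R -> C) : C :=
  Complex (Rintegral (@lebesgue_measure R) setT (fun t => complex.Re (f t)))
          (Rintegral (@lebesgue_measure R) setT (fun t => complex.Im (f t))).

Definition coth (x : R) : R := (expR x + expR (- x)) / (expR x - expR (- x)).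

Definition tent (t : R) : R := (2 / pi) * ln `|coth (pi * t / 2)|.

Variables (n J : nat).

Definition Gth (G : 'I_J -> 'M[C]_n) (th : 'I_J -> R) : 'M[C]_n :=
  \sum_(j < J) cR (th j) *: G j.

Definition rho (G : 'I_J -> 'M[C]_n) (th : 'I_J -> R) : 'M[C]_n :=
  (\tr (mexp (- Gth G th)))^-1 *: mexp (- Gth G th).

Definition pderiv (F : ('I_J -> R) -> 'M[C]_n) (th : 'I_J -> R) (j : 'I_J)
  : 'M[C]_n :=
  \matrix_(a, b)
    cderiv (fun s : R => F (fun i => th i + (if i == j then s else 0)) a b) 0.

Definition Phi (G : 'I_J -> 'M[C]_n) (th : 'I_J -> R) (X : 'M[C]_n)
  : 'M[C]_n :=
  \matrix_(a, b)
    cintegral (fun t : R =>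
      cR (tent t) *
      (mexp ((- (iC * cR t)) *: Gth G th) *m X
         *m mexp ((iC * cR t) *: Gth G th)) a b).

Definition ket (U : 'M[C]_n) (k : 'I_n) : 'cV[C]_n := col k U.
Definition bra (U : 'M[C]_n) (k : 'I_n) : 'rV[C]_n := ctr (col k U).

(* SLD built from a spectral decomposition rho = sum_k lam_k |k><k|
   (orthonormal basis given by the columns of U) and the derivative D = d_j rho:
   L = sum_{k,l} 2/(lam_k + lam_l) |k><k| D |l><l| *)
Definition SLD (U : 'M[C]_n) (lam : 'I_n -> R) (D : 'M[C]_n) : 'M[C]_n :=
  \sum_(k < n) \sum_(l < n)
    (2 / cR (lam k + lam l)) *: (ket U k *m bra U k *m D *m ket U l *m bra U l).

End QDefs.

(* Main.v *)
(* The SLD is the unique solution L of rho L + L rho = 2 (d_j rho), so it suffices to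
   verify this equation for L = - Phi (G_j) + Tr (G_j rho) in an eigenbasis of G(theta).
   With eigenvalues d_p, the (p, q) entry of d_j (exp (- G)) is - (G_j)_pq times the
   divided difference of exp at - d_p, - d_q (from the power series), and the (p, q)
   entry of Phi (G_j) is (G_j)_pq times the Fourier transform of the tent at
   w = d_q - d_p.  They match because that transform is tanh (w / 2) / (w / 2).

   For the transform, integrate p(t) = \sum_k 4 / a_k * exp (- a_k |t|), with
   a_k = (2 k + 1) pi, term by term; this gives \sum_k 8 / (a_k ^ 2 + w ^ 2).  That this
   is tanh (w / 2) / (w / 2) follows by iterating the duplication formula of coth and
   squeezing the resulting finite sums. *)

Require Import Defs.
From HB Require Import structures.
From mathcomp Require Import all_boot all_order all_algebra.
From mathcomp Require Import all_classical all_reals all_analysis.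
From mathcomp Require Import complex.
From mathcomp Require Import measurable_realfun ring lra zify.
Import Order.TTheory GRing.Theory Num.Theory.
Import numFieldTopology.Exports numFieldNormedType.Exports.
Local Open Scope classical_set_scope.
Local Open Scope ring_scope.

(** * Partial fractions of tanh *)

(** The identity to reach is that the divided difference (e^x - e^y) / (x - y), taken relative to
    the mean (e^x + e^y) / 2, equals tanh (w / 2) / (w / 2) with w = x - y; the tent is the density
    having this transform. The obstacle is exchanging limits. For sum and integral, the oscillating
    weights cos and sin rule out monotone convergence, so the computation is made with the
    nonnegative weights 1 + cos and 1 + sin; the total mass, itself a case of the same formula, is
    then subtracted. For the derivative of the exponential series, the second-order remainder of
    every partial sum is at most h ^ 2 times a constant independent of the number of terms, so that
    number may tend to infinity before h tends to 0. Two unrelated eigenbases occur: [U], given with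
    [rho] and otherwise arbitrary, and [V], which diagonalizes [Gth] and in which everything is
    computed. Only the positivity of the eigenvalues [lam] has to pass from [V] to [U]. Normalizing
    [rho] by its trace is what produces the term Tr (G_j rho). *)

Lemma le_of_derive_ge0 (R : realType) (f f' : R -> R) (b : R) :
  (forall t : R, is_derive t (1 : R) f (f' t)) -> (forall t, 0 < t < b -> 0 <= f' t) ->
  0 <= b -> f 0 <= f b.
Proof.
move=> df f'0 b0; have [<-//|] := eqVneq 0 b => b0'.
have {}b0' : 0 < b by rewrite lt_neqAle b0'.
apply: (@ger0_derive1_le_cc _ f 0 b) => //.
- by move=> t; rewrite in_itv/= => tb; rewrite derive1E derive_val f'0.
- by apply: derivable_within_continuous => t _; exact: ex_derive.
- by rewrite in_itv/= lexx b0.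
- by rewrite in_itv/= lexx b0.
Qed.

Section TanhSeries.
Variable R : realType.
Implicit Types x y b c : R.

Definition cosh x : R := (expR x + expR (- x)) / 2.
(** This is sinh x / x with its limit 1 filled in at 0, so that frequency 0 (equal eigenvalues) fits
    the same formulas. *)
Definition sinhc x : R := if x == 0 then 1 else (expR x - expR (- x)) / (2 * x).
Definition freq (k : nat) : R := (2 * k + 1)%:R * pi.

Lemma cosh0 : cosh 0 = 1.
Proof. by rewrite /cosh oppr0 expR0; field. Qed.

Lemma sinhc0 : sinhc 0 = 1.
Proof. by rewrite /sinhc eqxx. Qed.

Lemma sinhcN x : sinhc (- x) = sinhc x.
Proof.
rewrite /sinhc oppr_eq0; case: eqP => // /eqP x0.
by rewrite opprK; field.
Qed.

Lemma coshN x : cosh (- x) = cosh x.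
Proof. by rewrite /cosh opprK addrC. Qed.

Lemma sinhcE x : x * sinhc x = (expR x - expR (- x)) / 2.
Proof.
rewrite /sinhc; case: eqP => [->|/eqP x0]; first by rewrite oppr0 mul0r subrr mul0r.
by field.
Qed.

Lemma sinhc_double y : sinhc (2 * y) = sinhc y * cosh y.
Proof.
have [->|y0] := eqVneq y 0; first by rewrite mulr0 sinhc0 cosh0 mulr1.
rewrite /sinhc /cosh mulf_eq0 pnatr_eq0 /= (negbTE y0).
have e2 : expR (2 * y) = expR y * expR y by rewrite -expRD; congr expR; ring.
by rewrite !expRN e2; field; rewrite y0 gt_eqF ?expR_gt0.
Qed.

Lemma cosh_double y : cosh (2 * y) = 2 * cosh y ^+ 2 - 1.
Proof.
rewrite /cosh; have -> : 2 * y = y + y by ring.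
rewrite opprD !expRD expRN; have := expR_gt0 y => e0.
by field; rewrite gt_eqF.
Qed.

Lemma coshB1 y : cosh (2 * y) - 1 = 2 * (y * sinhc y) ^+ 2.
Proof.
rewrite cosh_double sinhcE /cosh expRN; have := expR_gt0 y => e0.
by field; rewrite gt_eqF.
Qed.

Lemma cosh_ge1 y : 1 <= cosh y.
Proof.
rewrite -subr_ge0 (_ : y = 2 * (y / 2)); last by field.
by rewrite coshB1 mulr_ge0// sqr_ge0.
Qed.

Lemma sinh_ge y : 0 <= y -> y <= (expR y - expR (- y)) / 2.
Proof.
pose f (t : R) := (expR t - expR (- t)) / 2 - t.
move=> y0; suff : f 0 <= f y by rewrite /f oppr0 subrr mul0r addr0 subr_ge0.
apply: (@le_of_derive_ge0 _ f (fun t => cosh t - 1)) => // t.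
  rewrite /f /cosh; apply: is_derive_eq.
  by rewrite /GRing.scale/=; ring.
by rewrite subr_ge0 cosh_ge1.
Qed.

Lemma sinh_le y : 0 <= y -> (expR y - expR (- y)) / 2 <= y * cosh y.
Proof.
pose f (t : R) := t * cosh t - (expR t - expR (- t)) / 2.
move=> y0; suff : f 0 <= f y by rewrite /f oppr0 subrr !mul0r subr0 subr_ge0.
apply: (@le_of_derive_ge0 _ f (fun t => t * ((expR t - expR (- t)) / 2))) => // t.
  rewrite /f /cosh; apply: is_derive_eq.
  by rewrite /GRing.scale/=; field.
move=> /andP[/ltW t0 _]; rewrite mulr_ge0//.
exact: le_trans t0 (sinh_ge _ t0).
Qed.

Lemma sinhc_bounds y : 1 <= sinhc y <= cosh y.
Proof.
wlog y0 : y / 0 < y.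
  move=> H; have [/H//|y0|<-] := ltgtP 0 y; last by rewrite sinhc0 cosh0 lexx.
  by rewrite -sinhcN -coshN H// oppr_gt0.
rewrite -(ler_pM2l y0) mulr1 -[X in _ && X](ler_pM2l y0) sinhcE.
by rewrite sinh_ge ?sinh_le// ltW.
Qed.

Lemma sin_le_id y : 0 <= y -> sin y <= y.
Proof.
pose f (t : R) := t - sin t.
move=> y0; suff : f 0 <= f y by rewrite /f sin0 subrr subr_ge0.
apply: (@le_of_derive_ge0 _ f (fun t => 1 - cos t)); last exact: y0.
by move=> t _; rewrite subr_ge0 cos_le1.
Qed.

Lemma mul_cos_le_sin y : 0 <= y <= pi -> y * cos y <= sin y.
Proof.
pose f (t : R) := sin t - t * cos t.
move=> /andP[y0 ypi]; suff : f 0 <= f y by rewrite /f sin0 mul0r subrr subr_ge0.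
apply: (@le_of_derive_ge0 _ f (fun t => t * sin t)) => // t.
  rewrite /f; apply: is_derive_eq.
  by rewrite /GRing.scale/=; ring.
move=> /andP[t0 ty]; rewrite mulr_ge0 ?(ltW t0)// sin_ge0_pi// (ltW t0) /=.
by rewrite (le_trans (ltW ty)).
Qed.

(** At [c = -1] this is tanh (x / 2) / x, half of the transform sought; the other values of [c]
    arise from duplication. *)
Definition coskernel x c : R := sinhc x / (cosh x - c).

(* [coskernel x (cos b)] is [Re (coth ((x + i b) / 2)) / x]; this is the real form
   of [2 coth (2 w) = coth w + coth (w + i pi / 2)]. *)
Lemma coskernel_double x b : cosh (x / 2) != cos (b / 2) ->
  cosh (x / 2) != cos (b / 2 + pi) ->
  coskernel x (cos b) =
  (coskernel (x / 2) (cos (b / 2)) + coskernel (x / 2) (cos (b / 2 + pi))) / 4.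
Proof.
rewrite cosDpi -subr_eq0 => h1; rewrite -subr_eq0 => h2.
have ex : x = 2 * (x / 2) by field.
have eb : b = (b / 2) *+ 2 by rewrite -mulr_natr; field.
rewrite /coskernel {1 2}ex {1}eb sinhc_double cosh_double cos_mulr2n.
rewrite opprK in h2 *.
have -> : 2 * cosh (x / 2) ^+ 2 - 1 - (cos (b / 2) ^+ 2 *+ 2 - 1) =
    2 * ((cosh (x / 2) - cos (b / 2)) * (cosh (x / 2) + cos (b / 2))) by ring.
by field; rewrite h1 h2.
Qed.

Lemma cos_lt1 b : 0 < b < 2 * pi -> cos b < 1.
Proof.
move=> /andP[b0 bp]; rewrite (_ : b = (b / 2) *+ 2); last first.
  by rewrite -mulr_natr; field.
rewrite cos_mulr2n cos2sin2.
have s0 : 0 < sin (b / 2) by apply: sin_gt0_pi; apply/andP; split; lra.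
have : 0 < sin (b / 2) ^+ 2 by rewrite exprn_gt0.
by rewrite -mulr_natr; lra.
Qed.

Lemma freqE k : freq k = (2 * k%:R + 1) * pi.
Proof. by rewrite /freq natrD natrM. Qed.

Lemma freq_gt0 k : 0 < freq k.
Proof. by rewrite mulr_gt0 ?pi_gt0// ltr0n addn1. Qed.

Lemma freq_lt k n : (k < n)%N -> freq k < 2 * n%:R * pi.
Proof.
by move=> kn; rewrite /freq ltr_pM2r ?pi_gt0// -natrM ltr_nat; lia.
Qed.

(** Induction from [-1 = cos pi] and [freq 0 = pi]. Duplication replaces an angle [b] by [b / 2] and
    [b / 2 + pi]; the second branch is the index shift [k + 2 ^ n], so the angles remain the odd
    multiples of [pi / 2 ^ n] in (0, 2 pi). *)
Lemma coskernel_sum x n : coskernel x (-1) =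
  4^-1 ^+ n * \sum_(0 <= k < 2 ^ n)
    coskernel (x / 2 ^+ n) (cos (freq k / 2 ^+ n)).
Proof.
elim: n => [|n IH].
  by rewrite big_nat1 /freq !expr0 !divr1 /= muln0 add0n !mul1r cospi.
have n2 : (2 ^+ n : R) != 0 by rewrite expf_neq0 ?pnatr_eq0.
have n2' : 0 < (2 ^+ n : R) by rewrite exprn_gt0.
have hx : x / 2 ^+ n / 2 = x / 2 ^+ n.+1 by rewrite exprS; field.
(* No denominator vanishes: the angles lie strictly between 0 and 2 pi, where cos < 1 <= cosh. *)
have hlt k : (k < 2 ^ n.+1)%N ->
    cosh (x / 2 ^+ n.+1) != cos (freq k / 2 ^+ n.+1).
  move=> kn; rewrite gt_eqF// (lt_le_trans _ (cosh_ge1 _))// cos_lt1//.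
  rewrite divr_gt0 ?freq_gt0 ?exprn_gt0//= ltr_pdivrMr ?exprn_gt0//.
  by rewrite mulrAC -natrX freq_lt.
have hb k : freq k / 2 ^+ n / 2 = freq k / 2 ^+ n.+1 by rewrite exprS; field.
have hp k : freq k / 2 ^+ n / 2 + pi = freq (k + 2 ^ n) / 2 ^+ n.+1.
  by rewrite !freqE exprS natrD natrX; field.
rewrite {1}IH.
under eq_big_nat => k /andP[_ kn].
  have k1 : (k < 2 ^ n.+1)%N by rewrite expnS; lia.
  have k2 : (k + 2 ^ n < 2 ^ n.+1)%N by rewrite expnS; lia.
  rewrite coskernel_double; first by rewrite hp hb hx over.
  - by rewrite hb hx hlt.
  - by rewrite hp hx hlt.
rewrite /= -mulr_suml big_split/= [4^-1 ^+ n.+1]exprSr -[RHS]mulrA; congr (_ * _).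
rewrite [LHS]mulrC; congr (_ * _).
rewrite expnS mul2n -addnn [RHS](@big_cat_nat _ _ _ (2 ^ n))//= ?leq_addr//.
congr (_ + _); symmetry.
by rewrite -{1}[(2 ^ n)%N]add0n big_addn addnK.
Qed.

Definition freq_sum x n : R := \sum_(0 <= k < n) 4 / (freq k ^+ 2 + x ^+ 2).

(** Split at 1: cosh y - 1 = 2 sinh (y / 2) ^ 2 is exact, and 1 - cos b = 2 sin (b / 2) ^ 2 is at
    most b ^ 2 / 2. The factor [sinhc (y / 2)] tends to 1 once [y] is scaled down. *)
Lemma cosh_sub_le y b :
  cosh y - cos b <= ((y * sinhc (y / 2)) ^+ 2 + b ^+ 2) / 2.
Proof.
have -> : cosh y - cos b = (cosh (2 * (y / 2)) - 1) + (1 - cos ((b / 2) *+ 2)).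
  have -> : 2 * (y / 2) = y by field.
  have -> : b / 2 *+ 2 = b by rewrite -mulr_natr; field.
  by rewrite addrA subrK.
rewrite coshB1 cos_mulr2n cos2sin2.
have : sin (b / 2) ^+ 2 <= (b / 2) ^+ 2.
  wlog b0 : b / 0 <= b.
    move=> H; have [/H//|b0] := leP 0 b.
    by have := H (- b); rewrite mulNr sinN !sqrrN; apply; lra.
  have [hb|hb] := leP b pi.
    by rewrite ler_sqr ?nnegrE ?sin_le_id ?sin_ge0_pi//; try (apply/andP; split); have := pi_gt0 R; lra.
  have h1 : sin (b / 2) ^+ 2 <= 1 by rewrite sin2cos2; have := sqr_ge0 (cos (b / 2)); lra.
  apply: le_trans h1 _; rewrite expr_ge1//; have := pi_ge2 R; lra.
by rewrite -mulr_natr; nra.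
Qed.

(** From tan h >= h with h = b / 2 one gets 1 / sin h ^ 2 <= 1 + 1 / h ^ 2. An additive error 1/2 is
    affordable: each term is later weighted by a multiple of 4 ^ -n and there are only 2 ^ n of
    them. *)
Lemma cosh_sub_ge y b : 0 < b < pi ->
  (cosh y - cos b)^-1 <= 2^-1 + 2 / (b ^+ 2 + y ^+ 2).
Proof.
move=> /andP[b0 bp].
pose s := sin (b / 2); pose c := cos (b / 2); pose h := b / 2.
have ecb : cos b = 1 - 2 * s ^+ 2.
  rewrite (_ : b = (b / 2) *+ 2); last by rewrite -mulr_natr; field.
  by rewrite cos_mulr2n cos2sin2 -/s -mulr_natr; ring.
have s0 : 0 < s by apply: sin_gt0_pi; apply/andP; split; lra.
have h0 : 0 < h by rewrite /h; lra.
have c0 : 0 <= c by apply: cos_ge0_pihalf; apply/andP; split; lra.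
have hcs : h * c <= s by apply: mul_cos_le_sin; apply/andP; split; rewrite /h; lra.
have cs1 : c ^+ 2 + s ^+ 2 = 1 by exact: cos2Dsin2.
have hv : y ^+ 2 / 2 <= cosh y - 1.
  rewrite {2}(_ : y = 2 * (y / 2)); last by field.
  rewrite coshB1 exprMn.
  have [h1 _] := andP (sinhc_bounds (y / 2)).
  have : 1 <= sinhc (y / 2) ^+ 2 by rewrite expr_ge1// (le_trans ler01).
  by have := sqr_ge0 y; rewrite exprMn; nra.
(* h^2 <= s^2 (1 + h^2), i.e. the bound tan h >= h *)
have hs : h ^+ 2 <= s ^+ 2 * (1 + h ^+ 2).
  have : (h * c) ^+ 2 <= s ^+ 2 by rewrite ler_sqr ?nnegrE ?mulr_ge0// ltW.
  by rewrite exprMn; nra.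
set v := cosh y - 1 in hv.
have -> : cosh y - cos b = v + 2 * s ^+ 2 by rewrite ecb /v; ring.
have u0 : 0 < 2 * s ^+ 2 by rewrite mulr_gt0// exprn_gt0.
have v0 : 0 <= v by apply: le_trans hv; rewrite divr_ge0 ?sqr_ge0.
have w0 : 0 < 2 * h ^+ 2 by rewrite mulr_gt0// exprn_gt0.
have hw : b ^+ 2 + y ^+ 2 = 2 * (2 * h ^+ 2 + y ^+ 2 / 2) by rewrite /h; field.
have y0 : 0 <= y ^+ 2 / 2 by rewrite divr_ge0 ?sqr_ge0.
rewrite {}hw; move: (y ^+ 2 / 2) y0 hv => z z0 zv.
move: hs u0 w0; move: (s ^+ 2) (h ^+ 2) => S H hs u0 w0.
apply: (@le_trans _ _ ((z + 2 * S)^-1)).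
  by rewrite lef_pV2 ?posrE; lra.
(* The numerator obtained below is nonnegative because [hs] gives [H - S <= S * H]. *)
rewrite -subr_ge0.
have -> : 2^-1 + 2 / (2 * (2 * H + z)) - (z + 2 * S)^-1 =
  ((2 * H + z) * (2 * S + z) - 4 * (H - S)) / (2 * (2 * H + z) * (2 * S + z)).
  by field; rewrite !gt_eqF; lra.
by rewrite divr_ge0 ?mulr_ge0; nra.
Qed.

Lemma freq_sym m k : (k < m)%N ->
  freq (2 * m - k.+1) = 2 * ((2 * m)%:R * pi) - freq k.
Proof.
move=> km; rewrite !freqE natrB; last by lia.
by rewrite natrM -natr1; ring.
Qed.

(** The reflection b -> 2 pi - b preserves the cosine and folds the upper half of the angles onto
    (0, pi). Without it, the angles near 2 pi would give large terms that b ^ 2 fails to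
    describe. *)
Lemma coskernel_half_sum x n : coskernel x (-1) =
  2 * 4^-1 ^+ n.+1 * \sum_(0 <= k < 2 ^ n)
    coskernel (x / 2 ^+ n.+1) (cos (freq k / 2 ^+ n.+1)).
Proof.
rewrite (coskernel_sum x n.+1) [2 * _]mulrC -[RHS]mulrA; congr (_ * _).
have n2 : (2 ^+ n.+1 : R) != 0 by rewrite expf_neq0 ?pnatr_eq0.
rewrite expnS (big_cat_nat (n := 2 ^ n))//=; last by lia.
rewrite mulr_natl mulr2n; congr (_ + _).
rewrite big_nat_rev/= -{1}[(2 ^ n)%N]add0n big_addn.
rewrite (_ : (2 * 2 ^ n - 2 ^ n)%N = (2 ^ n)%N); last by lia.
apply: eq_big_nat => k /andP[_ kn].
rewrite (_ : (2 ^ n + 2 * 2 ^ n - (k + 2 ^ n).+1 = 2 * 2 ^ n - k.+1)%N); last by lia.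
rewrite freq_sym// -expnS natrX mulrBl.
rewrite (_ : 2 * (2 ^+ n.+1 * pi) / 2 ^+ n.+1 = pi *+ 2); last first.
  by rewrite -mulr_natr; field.
by rewrite addrC cosD2pi cosN.
Qed.

Lemma coskernel_le x n : coskernel x (-1) <=
  sinhc (x / 2 ^+ n.+1) * (2^-1 ^+ n + freq_sum x (2 ^ n)).
Proof.
have n2 : (2 ^+ n.+1 : R) != 0 by rewrite expf_neq0 ?pnatr_eq0.
have n20 : 0 < (2 ^+ n.+1 : R) by rewrite exprn_gt0.
have s1 := andP (sinhc_bounds (x / 2 ^+ n.+1)).
rewrite (coskernel_half_sum x n) /coskernel -mulr_sumr mulrCA.
rewrite ler_pM2l; last by case: s1 => s1 _; rewrite (lt_le_trans ltr01).
rewrite mulr_sumr /freq_sum.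
(* The error is spread evenly over the [2 ^ n] terms; a share with factor 2 more than covers the 1/2
   of [cosh_sub_ge]. In the main term the dyadic scalings cancel. *)
have -> : 2^-1 ^+ n = \sum_(0 <= k < 2 ^ n) (2 * 4^-1 ^+ n.+1 * 2) :> R.
  rewrite sumr_const_nat subn0 -[RHS]mulr_natr natrX.
  rewrite (_ : 4^-1 = 2^-1 * 2^-1); last by field.
  by rewrite exprMn !exprVn exprS; field.
rewrite -big_split/= ler_sum_nat// => k /andP[_ kn].
apply: (@le_trans _ _ (2 * 4^-1 ^+ n.+1 * (2^-1 + 2 / ((freq k / 2 ^+ n.+1) ^+ 2 + (x / 2 ^+ n.+1) ^+ 2)))).
  rewrite ler_pM2l; last by rewrite mulr_gt0// exprn_gt0// invr_gt0.
  apply: cosh_sub_ge; rewrite divr_gt0 ?freq_gt0//= ltr_pdivrMr//.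
  by rewrite mulrC exprS -natrX freq_lt.
rewrite mulrDr lerD//.
  by rewrite ler_pM2l ?mulr_gt0 ?exprn_gt0 ?invr_gt0//; lra.
have fx : freq k ^+ 2 + x ^+ 2 != 0.
  by rewrite gt_eqF// ltr_pwDl ?sqr_ge0// exprn_gt0// freq_gt0.
rewrite (_ : 4^-1 = 2^-1 * 2^-1); last by field.
rewrite exprMn !exprVn le_eqVlt; apply/orP; left; apply/eqP.
by field; rewrite n2 fx.
Qed.

Lemma coskernel_ge x n :
  freq_sum x (2 ^ n) / sinhc (x / 2 ^+ n.+1 / 2) ^+ 2 <= coskernel x (-1).
Proof.
have n2 : (2 ^+ n.+1 : R) != 0 by rewrite expf_neq0 ?pnatr_eq0.
have n20 : 0 < (2 ^+ n.+1 : R) by rewrite exprn_gt0.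
have [s1 _] := andP (sinhc_bounds (x / 2 ^+ n.+1)).
have [s2 _] := andP (sinhc_bounds (x / 2 ^+ n.+1 / 2)).
rewrite (coskernel_half_sum x n) mulr_sumr /freq_sum mulr_suml.
rewrite ler_sum_nat// => k /andP[_ kn].
rewrite /coskernel.
set y := x / 2 ^+ n.+1 in s1 s2 *; set b := freq k / 2 ^+ n.+1.
set s := sinhc (y / 2) in s2 *.
have h := cosh_sub_le y b.
have d0 : 0 < cosh y - cos b.
  rewrite subr_gt0 (lt_le_trans _ (cosh_ge1 _))// cos_lt1//.
  rewrite divr_gt0 ?freq_gt0//= ltr_pdivrMr// mulrAC exprS.
  have e0 : 0 < 2 ^+ n :> R by rewrite exprn_gt0.
  by have := @freq_lt k (2 ^ n) kn; rewrite natrX; have := pi_gt0 R; nra.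
have f0 := freq_gt0 k.
have s20 : 1 <= s ^+ 2 by rewrite expr_ge1// (le_trans ler01).
have fx : 0 < freq k ^+ 2 + x ^+ 2.
  by rewrite ltr_pwDl ?sqr_ge0// exprn_gt0// freq_gt0.
apply: (@le_trans _ _ (2 * 4^-1 ^+ n.+1 * (cosh y - cos b)^-1)); last first.
  rewrite ler_pM2l; last by rewrite mulr_gt0// exprn_gt0// invr_gt0.
  by rewrite ler_peMl// invr_ge0 ltW.
apply: (@le_trans _ _ (2 * 4^-1 ^+ n.+1 * (((y ^+ 2 + b ^+ 2) * s ^+ 2) / 2)^-1)).
  have -> : 4^-1 ^+ n.+1 = (2 ^+ n.+1)^-1 * (2 ^+ n.+1)^-1 :> R.
    by rewrite -exprVn -exprMn; congr (_ ^+ _); field.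
  rewrite le_eqVlt; apply/orP; left; apply/eqP.
  rewrite /y /b; field.
  by rewrite n2 gt_eqF ?(lt_le_trans ltr01)//= addrC gt_eqF.
rewrite ler_pM2l; last by rewrite mulr_gt0// exprn_gt0// invr_gt0.
rewrite lef_pV2 ?posrE//.
  apply: le_trans h _; rewrite -/s.
  have : 0 <= b ^+ 2 * (s ^+ 2 - 1) by rewrite mulr_ge0 ?sqr_ge0 ?subr_ge0.
  lra.
have b20 : 0 < b ^+ 2 by rewrite exprn_gt0// divr_gt0.
have s0 : 0 < s ^+ 2 by exact: lt_le_trans ltr01 s20.
by rewrite divr_gt0// mulr_gt0//; have := sqr_ge0 y; lra.
Qed.

Lemma dyadic_cvg0 x : (fun n => x / 2 ^+ n.+1) @ \oo --> (0 : R).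
Proof.
under eq_fun do rewrite -exprVn exprS mulrA.
rewrite -(mulr0 (x / 2)); apply: cvgMr.
by apply: cvg_expr; rewrite ger0_norm ?invr_ge0// invf_lt1// ltr1n.
Qed.

Lemma sinhc_cvg (u : nat -> R) : u @ \oo --> (0 : R) -> (fun n => sinhc (u n)) @ \oo --> (1 : R).
Proof.
move=> u0; apply: (@squeeze_cvgr _ _ _ _ (cst 1) (fun n => cosh (u n))).
- by apply: nearW => n; exact: sinhc_bounds.
- exact: cvg_cst.
rewrite -cosh0 /cosh; apply: cvgMl; apply: cvgD.
  by apply: continuous_cvg => //; exact: continuous_expR.
apply: continuous_cvg; first exact: continuous_expR.
exact: cvgN.
Qed.

(** The bounds [coskernel_le] and [coskernel_ge] squeeze only the partial sums of length [2 ^ n];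
    positivity of the terms makes [freq_sum] monotone, which extends the limit to all lengths. *)
Lemma freq_sum_cvg x : freq_sum x n @[n --> \oo] --> coskernel x (-1).
Proof.
pose K := coskernel x (-1).
pose s1 n := sinhc (x / 2 ^+ n.+1); pose s2 n := sinhc (x / 2 ^+ n.+1 / 2) ^+ 2.
have s1c : s1 @ \oo --> (1 : R) by apply: sinhc_cvg; exact: dyadic_cvg0.
have s2c : s2 @ \oo --> (1 : R).
  rewrite -(mulr1 1); apply: cvgM; apply: sinhc_cvg;
    rewrite -(mul0r 2^-1); apply: cvgMl; exact: dyadic_cvg0.
have sub : freq_sum x (2 ^ n) @[n --> \oo] --> K.
  apply: (@squeeze_cvgr _ _ _ _ (fun n => K / s1 n - 2^-1 ^+ n) (fun n => K * s2 n)).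
  - apply: nearW => n.
    have [h1 _] := andP (sinhc_bounds (x / 2 ^+ n.+1)).
    have [h2 _] := andP (sinhc_bounds (x / 2 ^+ n.+1 / 2)).
    have h1' : 0 < s1 n by exact: lt_le_trans h1.
    have h2' : 0 < s2 n by rewrite exprn_gt0//; exact: lt_le_trans h2.
    rewrite lerBlDl ler_pdivrMr// mulrC coskernel_le/=.
    by rewrite -ler_pdivrMr// coskernel_ge.
  - rewrite -[X in _ --> X]subr0; apply: cvgB.
      rewrite -[X in _ --> X]divr1; apply: cvgMr; apply: cvgV => //.
    by apply: cvg_expr; rewrite ger0_norm ?invr_ge0// invf_lt1// ltr1n.
  - by rewrite -[X in _ --> X]mulr1; apply: cvgMr.
have ndf : nondecreasing_seq (freq_sum x).
  apply/nondecreasing_seqP => n; rewrite /freq_sum big_nat_recr//= lerDl.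
  by rewrite divr_ge0// addr_ge0 ?sqr_ge0.
have bnd n : freq_sum x n <= K.
  have nn : (n <= 2 ^ n)%N by apply: ltnW; exact: ltn_expl.
  apply: le_trans (ndf _ _ nn) _.
  rewrite -(cvg_lim _ sub)//; apply: limr_ge; first by apply/cvg_ex; exists K.
  near=> m; apply: ndf; rewrite leq_exp2l//; near: m; exact: nbhs_infty_ge.
apply/cvgrPdist_lt => e e0.
have /cvgrPdist_lt/(_ e e0)[N _ /(_ N (leqnn N))/=] := sub => hN.
near=> n.
have nN : freq_sum x (2 ^ N) <= freq_sum x n by apply: ndf; near: n; exact: nbhs_infty_ge.
have := bnd n; have := bnd (2 ^ N)%N; rewrite -/K => b1 b2.
by move: hN; rewrite !ger0_norm ?subr_ge0//; lra.
Unshelve. all: by end_near. Qed.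

End TanhSeries.

Arguments freq {R}.
Arguments coskernel {R}.
Arguments freq_sum {R}.

(** * The Fourier transform of the high-peak tent *)

Section TentFourier.
Variable R : realType.
Local Notation mu := (@lebesgue_measure R).

(** The remainder after [n] terms vanishes at 0 and has the closed derivative 2 u ^ (2 n) / (1 - u ^
    2), the tail of a geometric series. The mean value theorem then bounds it by a null geometric
    sequence. *)
Lemma ln_ratio_series (z : R) : 0 < z < 1 ->
  \sum_(0 <= k < n) 2 / (2 * k + 1)%:R * z ^+ (2 * k + 1) @[n --> \oo] -->
  ln ((1 + z) / (1 - z)).
Proof.
move=> /andP[z0 z1].
have zz : 0 < 1 - z ^+ 2 by rewrite subr_gt0 expr_lt1// ltW.
pose f n (u : R) := ln (1 + u) - ln (1 - u) -
  \sum_(0 <= k < n) 2 / (2 * k + 1)%:R * u ^+ (2 * k + 1).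
pose f' n (u : R) := 2 * u ^+ (2 * n) / (1 - u ^+ 2).
(* Induction on [n]: each new term subtracts its derivative 2 u ^ (2 n), which turns [f' n] into
   [f' n.+1]. *)
have df n (u : R) : 0 <= u < 1 -> is_derive u (1 : R) (f n) (f' n u).
  move=> /andP[u0 u1].
  have uu : 1 - u ^+ 2 != 0 by rewrite gt_eqF// subr_gt0 expr_lt1// ltW.
  have up : 1 + u != 0 by rewrite gt_eqF//; lra.
  have um : 1 - u != 0 by rewrite gt_eqF//; lra.
  rewrite /f; elim: n => [|n IH].
    have -> : (fun u0 : R => ln (1 + u0) - ln (1 - u0) -
        \sum_(0 <= k < 0) 2 / (2 * k + 1)%:R * u0 ^+ (2 * k + 1)) =
        (fun u0 => ln (1 + u0) - ln (1 - u0)).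
      by apply/funext => v; rewrite big_geq// subr0.
    have d1 : is_derive (1 + u) (1 : R) (@ln R) (1 + u)^-1 by apply: is_derive1_ln; lra.
    have d2 : is_derive (1 - u) (1 : R) (@ln R) (1 - u)^-1 by apply: is_derive1_ln; lra.
    have e1 : is_derive u (1 : R) (fun u0 : R => 1 + u0) 1.
      rewrite -[X in is_derive _ _ _ X]add0r.
      exact: (is_deriveD (is_derive_cst (1 : R) u 1) (is_derive_id u 1)).
    have e2 : is_derive u (1 : R) (fun u0 : R => 1 - u0) (-1).
      rewrite -[X in is_derive _ _ _ X]sub0r.
      exact: (is_deriveB (is_derive_cst (1 : R) u 1) (is_derive_id u 1)).
    have c1 := @is_derive1_comp R (@ln R) (fun u0 : R => 1 + u0) u _ _ d1 e1.
    have c2 := @is_derive1_comp R (@ln R) (fun u0 : R => 1 - u0) u _ _ d2 e2.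
    have := is_deriveB c1 c2; rewrite /comp /GRing.scale/= => H.
    apply: is_derive_eq.
    by rewrite /f' muln0 expr0; field; rewrite uu up um.
  have -> : (fun u0 : R => ln (1 + u0) - ln (1 - u0) -
        \sum_(0 <= k < n.+1) 2 / (2 * k + 1)%:R * u0 ^+ (2 * k + 1)) =
      (fun u0 => (ln (1 + u0) - ln (1 - u0) -
        \sum_(0 <= k < n) 2 / (2 * k + 1)%:R * u0 ^+ (2 * k + 1)) -
        2 / (2 * n + 1)%:R * u0 ^+ (2 * n).+1).
    by apply/funext => v; rewrite big_nat_recr//= opprD addrA addn1.
  have n0 : (2 * n + 1)%:R != 0 :> R by rewrite pnatr_eq0 addn1.
  have e3 : is_derive u (1 : R) (fun v : R => 2 / (2 * n + 1)%:R * v ^+ (2 * n).+1)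
      (2 * u ^+ (2 * n)).
    move: n0; rewrite addn1; move: (2 * n)%N => m m0.
    have := is_deriveZ (2 / m.+1%:R) (is_deriveX m.+1 (is_derive_id u (1 : R))).
    rewrite (_ : _ *: _ = 2 * u ^+ m) => [H|].
      rewrite (_ : (fun v : R => 2 / m.+1%:R * v ^+ m.+1) =
        (2 / m.+1%:R) \*: id ^+ m.+1); first exact: H.
      by apply/funext => v; rewrite /= fctE.
    by rewrite /GRing.scale/=; move: (m.+1%:R) m0 => q q0; field.
  apply: (is_derive_eq (is_deriveB IH e3)).
  by rewrite /f' mulnS exprD; field.
have f0 n : f n 0 = 0.
  rewrite /f addr0 subr0 subrr sub0r big1 ?oppr0// => k _.
  by rewrite addn1 expr0n mulr0.
have cf n : {within `[0, z], continuous (f n)}.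
  apply: derivable_within_continuous => u; rewrite in_itv/= => /andP[u0 uz].
  by have := df n u; rewrite u0 (le_lt_trans uz z1) => /(_ erefl) h; exact: ex_derive.
have bnd n : 0 <= f n z <= 2 * (z ^+ 2) ^+ n / (1 - z ^+ 2).
  have dfn (u : R) : u \in `]0, z[ -> is_derive u (1 : R) (f n) (f' n u).
    rewrite in_itv/= => /andP[u0 uz]; apply: df.
    by rewrite (ltW u0) (lt_trans uz z1).
  have [c] := MVT z0 dfn (cf n).
  rewrite in_itv/= => /andP[c0 cz]; rewrite f0 !subr0 => ->.
  have cc : 0 < 1 - c ^+ 2 by rewrite subr_gt0 expr_lt1 ?(lt_trans cz)// ltW.
  have c2 : c ^+ 2 <= z ^+ 2 by rewrite ler_sqr ?nnegrE ltW.
  have f'c : 0 < f' n c by rewrite /f' divr_gt0 ?mulr_gt0 ?exprn_gt0.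
  rewrite mulr_ge0 ?(ltW f'c) ?(ltW z0)//=.
  apply: (@le_trans _ _ (f' n c)).
    by rewrite ger_pMr// ltW.
  rewrite /f' exprM ler_pM ?mulr_ge0 ?invr_ge0 ?exprn_ge0 ?sqr_ge0 ?(ltW cc) ?(ltW c0)//.
    by rewrite ler_pM2l// lerXn2r ?nnegrE ?sqr_ge0.
  by rewrite lef_pV2 ?posrE//; lra.
have lim : (fun n => 2 * (z ^+ 2) ^+ n / (1 - z ^+ 2)) @ \oo --> (0 : R).
  rewrite -[X in _ --> X](mul0r (1 - z ^+ 2)^-1); apply: cvgMl.
  rewrite -[X in _ --> X](mulr0 2); apply: cvgMr; apply: cvg_expr.
  by rewrite ger0_norm ?sqr_ge0// expr_lt1// ltW.
have fl : f n z @[n --> \oo] --> (0 : R).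
  apply: (@squeeze_cvgr _ _ _ _ (cst 0) (fun n => 2 * (z ^+ 2) ^+ n / (1 - z ^+ 2))) => //.
    by apply: nearW => n; exact: bnd.
  exact: cvg_cst.
have -> : ln ((1 + z) / (1 - z)) = ln (1 + z) - ln (1 - z) - 0.
  by rewrite subr0 ln_div ?posrE//; lra.
have -> : (fun n => \sum_(0 <= k < n) 2 / (2 * k + 1)%:R * z ^+ (2 * k + 1)) =
   (fun n => (ln (1 + z) - ln (1 - z)) - f n z).
  by apply/funext => n; rewrite /f opprB addrC subrK.
by apply: cvgB => //; exact: cvg_cst.
Qed.

Definition tent_term (k : nat) (t : R) : R := 4 / freq k * expR (- (freq k * `|t|)).

Lemma tentN (t : R) : tent (- t) = tent t.
Proof.
rewrite /tent /coth; congr (_ * ln _).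
rewrite mulrN mulNr opprK.
by rewrite addrC -[X in _ / X]opprB invrN mulrN normrN.
Qed.

(** With z = exp (- pi t), coth (pi t / 2) = (1 + z) / (1 - z). At 0 the series diverges while
    [tent 0] is 0 by the conventions for division and [ln], hence the exclusion of that null
    point. *)
Lemma tent_series (t : R) : t != 0 ->
  \sum_(0 <= k < n) tent_term k t @[n --> \oo] --> tent t.
Proof.
wlog t0 : t / 0 < t.
  move=> H; have [t0|t0|_] := ltgtP 0 t; last by [].
    by move=> _; apply: H => //; rewrite gt_eqF.
  move=> _; rewrite -tentN; rewrite /tent_term -normrN.
  by apply: H; rewrite ?oppr_eq0 ?lt_eqF// oppr_gt0.
move=> _; have p0 := pi_gt0 R.
pose z := expR (- (pi * t)).
have z0 : 0 < z by exact: expR_gt0.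
have z1 : z < 1 by rewrite expR_lt1 oppr_lt0 mulr_gt0.
have -> : tent t = (2 / pi) * ln ((1 + z) / (1 - z)).
  rewrite /tent; congr (_ * ln _).
  have e2 : z = expR (- (pi * t / 2)) * expR (- (pi * t / 2)).
    by rewrite -expRD; congr expR; field.
  rewrite /coth e2.
  have e0 := expR_gt0 (- (pi * t / 2)).
  have -> : expR (pi * t / 2) = (expR (- (pi * t / 2)))^-1 by rewrite -expRN opprK.
  have ee : expR (- (pi * t / 2)) < 1.
    by rewrite expR_lt1 oppr_lt0 divr_gt0// mulr_gt0.
  move: (expR _) e0 ee => e e0 e1.
  have ee1 : e * e < 1 by nra.
  rewrite -[RHS]ger0_norm; last by rewrite divr_ge0; nra.
  by congr (`| _ |); field; rewrite !gt_eqF//; lra.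
have -> : (fun n => \sum_(0 <= k < n) tent_term k t) =
  (fun n => 2 / pi * \sum_(0 <= k < n) 2 / (2 * k + 1)%:R * z ^+ (2 * k + 1)).
  apply/funext => n; rewrite mulr_sumr; apply: eq_bigr => k _.
  rewrite /tent_term /z -expRM_natl /freq gtr0_norm//.
  have k0 : (2 * k + 1)%:R != 0 :> R by rewrite pnatr_eq0 addn1.
  have -> : - ((2 * k + 1)%:R * pi * t) = (2 * k + 1)%:R * - (pi * t) by ring.
  by move: ((2 * k + 1)%:R) k0 pi p0 => q q0 p p0; field; rewrite q0 gt_eqF.
by apply: cvgMr; apply: ln_ratio_series; rewrite z0.
Qed.

Lemma tent_term_ge0 k t : 0 <= tent_term k t.
Proof. by rewrite mulr_ge0 ?expR_ge0// divr_ge0// ltW// freq_gt0. Qed.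

Lemma continuous_tent_term k : continuous (tent_term k).
Proof.
move=> t; rewrite /tent_term; apply: cvgMr.
apply: (@continuous_comp _ _ _ (fun t : R => - (freq k * `|t|)) expR); last exact: continuous_expR.
by apply: cvgN; apply: cvgMr; exact: norm_continuous.
Qed.

Lemma tent_eseries (t : R) : t != 0 ->
  (\sum_(k <oo) (tent_term k t)%:E = (tent t)%:E)%E.
Proof.
move=> t0; apply/cvg_lim => //.
under eq_fun do rewrite sumEFin.
by apply: cvg_EFin; [exact: nearW|exact: tent_series].
Qed.

Lemma tent_ge0 (t : R) : 0 <= tent t.
Proof.
have [->|t0] := eqVneq t 0.
  by rewrite /tent /coth mulr0 mul0r oppr0 subrr invr0 mulr0 normr0 ln0// mulr0.
rewrite -lee_fin -tent_eseries//; apply: nneseries_ge0 => k _ _.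
by rewrite lee_fin tent_term_ge0.
Qed.

Lemma measurable_tent : measurable_fun setT (@tent R).
Proof.
rewrite -(@setD1K _ (0 : R) setT)//; apply/measurable_funU => //.
  exact: measurableD.
split; first exact: measurable_fun_set1.
apply: (@measurable_fun_cvg _ _ _ _ (fun n t => \sum_(0 <= k < n) tent_term k t)).
  move=> n; apply: measurable_sum => k; apply: measurable_funTS.
  apply: continuous_measurable_fun; exact: continuous_tent_term.
by move=> t [_ /eqP t0]; exact: tent_series.
Qed.

Lemma ge0_integralT_fold (f : R -> R) : (forall x, 0 <= f x) -> continuous f ->
  (\int[mu]_x (f x)%:E = \int[mu]_(x in `[0%R, +oo[) (f x + f (- x))%:E)%E.
Proof.
move=> f0 cf.
have mf : measurable_fun [set: R] f by exact: continuous_measurable_fun.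
have mposnums : measurable [set x : R | 0 <= x]%R by rewrite -set_itvcy.
have cfN : continuous (f \o -%R).
  by move=> x; apply: continuous_comp; [exact: opp_continuous|exact: cf].
rewrite -(setUv [set x : R | 0 <= x]%R) ge0_integral_setU//= ; last 4 first.
  exact: measurableC.
  by apply/measurable_EFinP; rewrite setUv.
  by move=> x _; rewrite lee_fin.
  exact/disj_setPCl.
rewrite -set_itvcy// setCitvr.
rewrite integral_itv_bndo_bndc; last exact/measurable_EFinP/measurable_funTS.
rewrite -{2}oppr0 ge0_integration_by_substitutionNy//; last exact: continuous_subspaceT.
under [RHS]eq_integral do rewrite EFinD.
rewrite [RHS]ge0_integralD//.
- by move=> t _; rewrite lee_fin.
- by apply/measurable_EFinP; apply: measurable_funTS; exact: mf.
- by move=> t _; rewrite lee_fin.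
- apply/measurable_EFinP; apply: measurable_funTS.
  exact: continuous_measurable_fun.
Qed.

(** The condition on [c] keeps the integrand nonnegative, so the fundamental theorem on a half-line
    applies without a prior proof of integrability. *)
Lemma exp_cos_integral (a w c : R) : 0 < a -> `|c| <= 1 ->
  (\int[mu]_(t in `[0%R, +oo[) (expR (- (a * t)) * (2 + 2 * c * cos (w * t)))%:E
   = (2 / a + 2 * c * a / (a ^+ 2 + w ^+ 2))%:E)%E.
Proof.
move=> a0 c1.
have aw : a ^+ 2 + w ^+ 2 != 0 by rewrite gt_eqF// ltr_pwDl ?sqr_ge0// exprn_gt0.
pose f (t : R) := expR (- (a * t)) * (2 + 2 * c * cos (w * t)).
(* An antiderivative vanishing at infinity; the integral is therefore [- F 0]. *)
pose F (t : R) := expR (- (a * t)) *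
  (- (2 / a) + 2 * c * (w * sin (w * t) - a * cos (w * t)) / (a ^+ 2 + w ^+ 2)).
have cc (x : R) : `|c * cos x| <= 1.
  by rewrite normrM -(mulr1 1) ler_pM// cos_max.
have dF (t : R) : is_derive t (1 : R) F (f t).
  rewrite /F; apply: is_derive_eq.
  rewrite /f /GRing.scale/=; field.
  by rewrite aw gt_eqF.
have df (t : R) : derivable f t 1 by rewrite /f; exact: ex_derive.
rewrite (@ge0_continuous_FTC2y R f F 0 0).
- rewrite -EFinB; congr EFin; rewrite /F !mulr0 oppr0 expR0 sin0 cos0; field.
  by rewrite aw gt_eqF.
- move=> t t0; rewrite /f mulr_ge0 ?expR_ge0//.
  by have := cc (w * t); rewrite ler_norml => /andP[h _]; lra.
- by apply: derivable_within_continuous => t _.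
- pose M := 2 / a + 2 * (`|w| + a) / (a ^+ 2 + w ^+ 2).
  have bF t : `|F t| <= expR (- (a * t)) * M.
    rewrite /F normrM ger0_norm ?expR_ge0// ler_wpM2l ?expR_ge0//.
    apply: le_trans (ler_normD _ _) _; rewrite normrN lerD//.
      by rewrite ger0_norm// divr_ge0// ltW.
    rewrite !normrM normfV [`|a ^+ 2 + _|]ger0_norm ?addr_ge0 ?sqr_ge0//.
    rewrite ler_pM2r; last by rewrite invr_gt0 lt_def aw addr_ge0 ?sqr_ge0.
    rewrite ger0_norm// -mulrA ler_pM2l//.
    rewrite -[leRHS]mul1r ler_pM//.
    apply: le_trans (ler_normB _ _) _; rewrite !normrM lerD//.
      by rewrite ler_piMr// sin_max.
    by rewrite gtr0_norm// ler_piMr ?(ltW a0)// cos_max.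
  apply: norm_cvg0; apply: (@squeeze_cvgr _ _ _ _ (cst 0) (fun t => expR (- (a * t)) * M)).
  + by apply: nearW => t; rewrite normr_ge0 bF.
  + exact: cvg_cst.
  + rewrite -[X in _ --> X](mul0r M); apply: cvgMl.
    apply: (@cvg_comp _ _ _ (fun t : R => a * t) (fun t => expR (- t)) _ +oo).
      exact: gt0_cvgMry.
    exact: cvgr_expR.
- by move=> t _; exact: ex_derive.
- apply: cvg_at_right_filter; apply: differentiable_continuous.
  by apply/derivable1_diffP; exact: ex_derive.
- by move=> t _; rewrite derive1E derive_val.
Qed.

Definition tent_ft (w : R) : R := 2 * coskernel w (-1).

(** One statement serves the weights 1, 1 + cos and 1 + sin, since only [g t + g (- t)] matters
    against an even density. Nonnegativity of [g] justifies integrating the series term by term. *)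
Lemma tent_integral (g : R -> R) (w c : R) : continuous g ->
  (forall t, 0 <= g t) -> `|c| <= 1 ->
  (forall t, g t + g (- t) = 2 + 2 * c * cos (w * t)) ->
  (\int[mu]_t (tent t * g t)%:E = (1 + c * tent_ft w)%:E)%E.
Proof.
move=> cg g0 c1 ge.
have mg : measurable_fun setT g by exact: continuous_measurable_fun.
have mD : measurable ([set: R] `\ 0) by exact: measurableD.
have mtg k : measurable_fun setT (fun t => tent_term k t * g t).
  by apply: measurable_funM => //; apply: continuous_measurable_fun; exact: continuous_tent_term.
rewrite -(@integral_setD1 _ _ 0)//; last first.
  by apply/measurable_EFinP/measurable_funTS/measurable_funM => //; exact: measurable_tent.
under eq_integral => t.
  rewrite inE => -[_ /eqP t0].
  rewrite mulrC EFinM -tent_eseries// -nneseriesZl; last by move=> k _; rewrite lee_fin tent_term_ge0.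
  under eq_eseriesr do rewrite -EFinM mulrC.
  over.
rewrite integral_nneseries//=; last 2 first.
- by move=> k; apply/measurable_EFinP; apply: measurable_funTS; exact: mtg.
- by move=> k t _; rewrite lee_fin mulr_ge0// tent_term_ge0.
have term k : (\int[mu]_(t in [set: R] `\ 0%R) (tent_term k t * g t)%:E =
   (2 * (4 / (freq k ^+ 2 + 0 ^+ 2)) + c * (2 * (4 / (freq k ^+ 2 + w ^+ 2))))%:E)%E.
  (* Each single term is continuous at 0, so the point removed for the sake of the series can be put
     back. *)
  rewrite integral_setD1//; last by apply/measurable_EFinP; apply: measurable_funTS; exact: mtg.
  rewrite ge0_integralT_fold; last 2 first.
  - by move=> t; rewrite mulr_ge0// tent_term_ge0.
  - by move=> t; apply: cvgM; [exact: continuous_tent_term|exact: cg].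
  have f0 : 0 < freq k :> R by exact: freq_gt0.
  transitivity ((4 / freq k)%:E * \int[mu]_(t in `[0%R, +oo[)
     (expR (- (freq k * t)) * (2 + 2 * c * cos (w * t)))%:E)%E.
    rewrite -ge0_integralZl//; last 3 first.
    - apply/measurable_EFinP; apply: measurable_funTS.
      apply: continuous_measurable_fun => t.
      apply: differentiable_continuous; apply/derivable1_diffP; exact: ex_derive.
    - move=> t _; rewrite lee_fin mulr_ge0 ?expR_ge0// -ge addr_ge0//.
    - by rewrite lee_fin divr_ge0// ltW.
    apply: eq_integral => t; rewrite inE/= in_itv/= andbT => t0.
    rewrite -EFinM -ge /tent_term normrN ger0_norm//; congr EFin; ring.
  rewrite exp_cos_integral// -EFinM; congr EFin.
  have d1 : freq k != 0 :> R by rewrite gt_eqF.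
  have d2 : freq k ^+ 2 + w ^+ 2 != 0.
    by rewrite gt_eqF// ltr_pwDl ?sqr_ge0// exprn_gt0.
  by rewrite expr0n addr0; field; rewrite d1 d2.
under eq_eseriesr do rewrite term.
apply/cvg_lim => //.
rewrite (_ : (fun _ => _) =
    (fun n => (2 * freq_sum 0 n + c * (2 * freq_sum w n))%:E)); last first.
  by apply/funext => n; rewrite sumEFin big_split/= /freq_sum !mulr_sumr.
apply: cvg_EFin; first exact: nearW.
(* The constant 1 is the transform at frequency 0. *)
rewrite (_ : 1 + _ = 2 * coskernel 0 (-1) + c * tent_ft w); last first.
  by congr (_ + _); rewrite /coskernel sinhc0 cosh0; field.
by apply: cvgD; do ?apply: cvgMr; exact: freq_sum_cvg.
Qed.

Lemma tent_integral1 : (\int[mu]_t (tent t)%:E = 1%:E)%E.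
Proof.
have := @tent_integral (cst 1) 0 0.
under eq_integral do rewrite mulr1.
rewrite mul0r addr0 normr0; apply => //; first by move=> t; exact: cvg_cst.
by move=> t; rewrite /cst mulr0 mul0r addr0.
Qed.

Lemma integrable_tent : mu.-integrable setT (EFin \o @tent R).
Proof.
apply/integrableP; split; first by apply/measurable_EFinP; exact: measurable_tent.
under eq_integral do rewrite /= ger0_norm ?tent_ge0//.
by rewrite tent_integral1 ltry.
Qed.

Lemma integrable_tentM (g : R -> R) : continuous g -> (forall t, `|g t| <= 1) ->
  mu.-integrable setT (fun t => (tent t * g t)%:E).
Proof.
move=> cg g1; apply: (le_integrable _ _ _ integrable_tent) => //.
  apply/measurable_EFinP; apply: measurable_funM; first exact: measurable_tent.
  exact: continuous_measurable_fun.
move=> t _; rewrite lee_fin normrM ler_piMr//.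
Qed.

(** Adding 1 to [g] makes it nonnegative; the contribution of that 1 is the mass of the tent and
    cancels. *)
Lemma Rintegral_tentM (g : R -> R) (w c : R) : continuous g ->
  (forall t, `|g t| <= 1) -> `|c| <= 1 ->
  (forall t, g t + g (- t) = 2 * c * cos (w * t)) ->
  Rintegral mu setT (fun t => tent t * g t) = c * tent_ft w.
Proof.
move=> cg g1 c1 ge.
have h : (\int[mu]_t (tent t * (1 + g t))%:E = (1 + c * tent_ft w)%:E)%E.
  apply: tent_integral => //.
  - by move=> t; apply: cvgD; [exact: cvg_cst|exact: cg].
  - by move=> t; have := g1 t; rewrite ler_norml => /andP[? _]; lra.
  - by move=> t; rewrite addrACA ge.
have : Rintegral mu setT (fun t => tent t + tent t * g t) = 1 + c * tent_ft w.
  rewrite /Rintegral; under eq_integral do rewrite -[X in X + _]mulr1 -mulrDr.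
  by rewrite h.
rewrite RintegralD//; last 2 first.
- exact: integrable_tent.
- exact: integrable_tentM.
by rewrite {1}/Rintegral tent_integral1 /= => /addrI.
Qed.

Lemma continuous_scaled (f : R -> R) (w : R) : continuous f ->
  continuous (fun t => f (w * t)).
Proof.
move=> cf t; apply: continuous_comp; last exact: cf.
by apply: cvgMr; exact: cvg_id.
Qed.

Lemma Rintegral_tent_cos (w : R) :
  Rintegral mu setT (fun t => tent t * cos (w * t)) = tent_ft w.
Proof.
rewrite -[RHS]mul1r; apply: Rintegral_tentM; rewrite ?normr1//.
- by apply: continuous_scaled; exact: continuous_cos.
- by move=> t; exact: cos_max.
- by move=> t; rewrite mulrN cosN; ring.
Qed.

Lemma Rintegral_tent_sin (w : R) :
  Rintegral mu setT (fun t => tent t * sin (w * t)) = 0.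
Proof.
rewrite -[RHS](mul0r (tent_ft w)); apply: Rintegral_tentM; rewrite ?normr0//.
- by apply: continuous_scaled; exact: continuous_sin.
- by move=> t; exact: sin_max.
- by move=> t; rewrite mulrN sinN; ring.
Qed.

End TentFourier.

Arguments tent_ft {R}.

(** * Limits and integrals of complex functions, matrix exponentials *)

HB.instance Definition _ (R : realType) :=
  GRing.RMorphism.copy (@cR R) (real_complex R).

Section ComplexLimits.
Variable R : realType.
Local Notation C := (cnum R).
Implicit Types z w : R[i].
Local Notation nc := (@ComplexField.Normc.normc R).

Lemma nc_ge0 z : 0 <= nc z.
Proof. by case: z => a b; exact: sqrtr_ge0. Qed.

Lemma cR_lt (x y : R) : (cR x < cR y) = (x < y).
Proof. exact: ltcR. Qed.

Lemma ncD z w : nc (z + w) <= nc z + nc w.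
Proof. exact: (@le_normcD R z w). Qed.

Lemma ncN z : nc (- z) = nc z.
Proof. exact: (@normcN R z). Qed.

Lemma ncR (x : R) : nc (cR x) = `|x|.
Proof. by rewrite /ComplexField.Normc.normc /cR expr0n addr0 sqrtr_sqr. Qed.

(* An inductive wrapper rather than a definition: it keeps unification from
   unfolding the topology of R[i]. *)
Variant complex_cvg {T : Type} (F : set_system T) (f : T -> R[i]) (l : R[i]) : Prop :=
  ComplexCvg of (f : T -> C) @ F --> (l : C).

Section ComplexCvg.
Context {T : Type} {F : set_system T} {FF : ProperFilter F}.
Implicit Types (f g : T -> R[i]) (a b c l : R[i]).

(** Reduces complex limits to real ones, where squeezing is available. *)
Lemma complex_cvgP f l :
  complex_cvg F f l <-> nc (f x - l) @[x --> F] --> (0 : R).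
Proof.
split.
- move=> [/(@cvgr_dist_lt C C _ _ _ f l) fl]; apply/cvgr0Pnorm_lt => e e0.
  have e0' : (0 : C) < cR e by rewrite (cR_lt 0).
  apply: filterS (fl _ e0') => x /=.
  move=> h; have {h} : cR (nc (l - f x)) < cR e := h.
  by rewrite cR_lt -ncN opprB ger0_norm ?nc_ge0.
- move=> /cvgr0Pnorm_lt h; split; apply/(@cvgrPdist_lt C C) => e e0.
  (* The order of [R[i]] compares only numbers with the same imaginary part, so a positive [e] is
     real. *)
  have [e1 e10 ->] : exists2 e1, 0 < e1 & e = cR e1.
    by move: e0; case: e => x y; rewrite ltcE /= => /andP[/eqP -> x0]; exists x.
  apply: filterS (h _ e10) => x /=.
  rewrite ger0_norm ?nc_ge0// -ncN opprB => h1.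
  by have : cR (nc (l - f x)) < cR e1 by rewrite cR_lt.
Qed.

Lemma complex_lim f l : complex_cvg F f l -> lim (f @ F) = l.
Proof. by move=> [/(@cvg_lim C (@norm_hausdorff C C))]. Qed.

Lemma complex_cvg_cst a : complex_cvg F (fun=> a) a.
Proof. by split; exact: cvg_cst. Qed.

Lemma complex_cvg_real (f : T -> R) (l : R) :
  f @ F --> l -> complex_cvg F (fun x => cR (f x)) (cR l).
Proof.
move=> fl; apply/complex_cvgP.
under eq_fun do rewrite -rmorphB ncR.
have : (fun x => `|f x - l|) @ F --> (`|0 : R| : R).
  by apply: cvg_norm; rewrite -(subrr l); apply: cvgB => //; exact: cvg_cst.
by rewrite normr0.
Qed.

Lemma complex_cvgD f g a b : complex_cvg F f a -> complex_cvg F g b ->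
  complex_cvg F (fun x => f x + g x) (a + b).
Proof. by move=> [fa] [gb]; split; apply: (@cvgD C C T F FF f g a b fa gb). Qed.

Lemma complex_cvgB f g a b : complex_cvg F f a -> complex_cvg F g b ->
  complex_cvg F (fun x => f x - g x) (a - b).
Proof. by move=> [fa] [gb]; split; apply: (@cvgB C C T F FF f g a b fa gb). Qed.

Lemma complex_cvgM f g a b : complex_cvg F f a -> complex_cvg F g b ->
  complex_cvg F (fun x => f x * g x) (a * b).
Proof. by move=> [fa] [gb]; split; apply: (@cvgM C T F FF f g a b fa gb). Qed.

Lemma complex_cvgV f a : a != 0 -> complex_cvg F f a ->
  complex_cvg F (fun x => (f x)^-1) a^-1.
Proof. by move=> a0 [fa]; split; apply: (@cvgV C T F FF f a a0 fa). Qed.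

Lemma complex_cvgMr f c a : complex_cvg F f a -> complex_cvg F (fun x => c * f x) (c * a).
Proof. by move=> fa; apply: (complex_cvgM _ _ _ _ _ fa); exact: complex_cvg_cst. Qed.

Lemma complex_cvgMl f c a : complex_cvg F f a -> complex_cvg F (fun x => f x * c) (a * c).
Proof. by move=> fa; apply: (complex_cvgM _ _ _ _ fa); exact: complex_cvg_cst. Qed.

Lemma complex_cvg_near f g l : (\forall x \near F, f x = g x) ->
  complex_cvg F f l -> complex_cvg F g l.
Proof.
move=> fg [fl]; split; apply: cvg_trans fl; apply: near_eq_cvg.
by apply: filterS fg => x ->.
Qed.

Lemma complex_cvg_sum (I : Type) (s : seq I) (f : I -> T -> R[i]) (l : I -> R[i]) :
  (forall i, complex_cvg F (f i) (l i)) ->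
  complex_cvg F (fun x => \sum_(i <- s) f i x) (\sum_(i <- s) l i).
Proof.
move=> h; elim: s => [|i s IH].
  rewrite big_nil (_ : (fun _ => _) = (fun=> 0)); first exact: complex_cvg_cst.
  by apply/funext => x; rewrite big_nil.
rewrite big_cons (_ : (fun _ => _) = (fun x => f i x + \sum_(k <- s) f k x)).
  by apply: complex_cvgD; [exact: h|exact: IH].
by apply/funext => x; rewrite big_cons.
Qed.

End ComplexCvg.

Definition cexp_sum (z : R[i]) (N : nat) : R[i] := \sum_(k < N) (k`!%:R)^-1 * z ^+ k.

Definition cis (x : R) : R[i] := Complex (cos x) (sin x).

Lemma cexp_sum_real (x : R) : complex_cvg \oo (cexp_sum (cR x)) (cR (expR x)).
Proof.
have -> : cexp_sum (cR x) = fun N => cR (series (exp_coeff x) N).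
  apply/funext => N; rewrite /cexp_sum /series/= big_mkord.
  rewrite rmorph_sum; apply: eq_bigr => k _.
  by rewrite /exp_coeff /= rmorphM/= rmorphXn/= fmorphV rmorph_nat mulrC.
by apply: complex_cvg_real; exact: is_cvg_series_exp_coeff.
Qed.

Lemma cexp_sum_imag (y : R) : complex_cvg \oo (cexp_sum (iC R * cR y)) (cis y).
Proof.
(* One of the two coefficients is zero according to the parity of [k], and the powers of [iC] supply
   the signs. *)
have term k : (k`!%:R)^-1 * (iC R * cR y) ^+ k =
    cR (cos_coeff y k) + iC R * cR (sin_coeff y k).
  have ii : iC R ^+ 2 = -1 by exact: (sqr_i R).
  rewrite /cos_coeff /sin_coeff /= !rmorphM/= !rmorphXn/= !fmorphV !rmorph_nat rmorphN1.
  rewrite exprMn -[in iC R ^+ k](odd_double_half k) exprD -mul2n exprM ii.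
  case ok: (odd k) => /=.
    have -> : k.-1./2 = k./2.
      by move: (odd_double_half k); rewrite ok; lia.
    by rewrite expr1; ring.
  by rewrite expr0; ring.
have -> : cexp_sum (iC R * cR y) =
    fun N => cR (series (cos_coeff y) N) + iC R * cR (series (sin_coeff y) N).
  apply/funext => N; rewrite /cexp_sum /series/= !big_mkord.
  rewrite !rmorph_sum mulr_sumr -big_split/=.
  by apply: eq_bigr => k _; exact: term.
have -> : cis y = cR (cos y) + iC R * cR (sin y).
  by rewrite /cis /cR /iC; simpc.
apply: complex_cvgD; last apply: complex_cvgMr; apply: complex_cvg_real;
  rewrite unlock.
  exact: is_cvg_series_cos_coeff.
exact: is_cvg_series_sin_coeff.
Qed.

End ComplexLimits.

Arguments complex_cvg {R T}.
Arguments cexp_sum {R}.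
Arguments cis {R}.

Section MatrixExp.
Variable R : realType.
Local Notation C := (cnum R).
Local Notation nc := (@ComplexField.Normc.normc R).

Definition mx_cvg {T : Type} {n : nat} (F : set_system T) (S : T -> 'M[R[i]]_n)
    (E : 'M[R[i]]_n) :=
  forall a b, complex_cvg F (fun x => S x a b) (E a b).

Definition mexp_sum {n : nat} (A : 'M[R[i]]_n) (N : nat) : 'M[R[i]]_n :=
  \sum_(k < N) (k`!%:R)^-1 *: A ^+ k.

(** As [mexp] is a [lim], it yields a mere default value without convergence; so exponentials are
    always handled through a convergence statement. *)
Lemma mexpE n (A E : 'M[R[i]]_n) : mx_cvg \oo (mexp_sum A) E -> mexp A = E.
Proof. by move=> h; apply/matrixP => a b; rewrite mxE; apply: complex_lim; exact: h. Qed.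

Lemma mx_cvg_mul (T : Type) (F : set_system T) (FF : ProperFilter F)
    n (V W : 'M[R[i]]_n) (S : T -> 'M[R[i]]_n) E : mx_cvg F S E ->
  mx_cvg F (fun N => V *m S N *m W) (V *m E *m W).
Proof.
move=> h a b; rewrite mxE.
rewrite (_ : (fun _ => _) = (fun x => \sum_c (V *m S x) a c * W c b)); last first.
  by apply/funext => x; rewrite mxE.
apply: complex_cvg_sum => c; apply: complex_cvgMl; rewrite mxE.
rewrite (_ : (fun _ => _) = (fun x => \sum_k V a k * S x k c)); last first.
  by apply/funext => x; rewrite mxE.
by apply: complex_cvg_sum => k; apply: complex_cvgMr; exact: h.
Qed.

Lemma mx_conjX n (V W A : 'M[R[i]]_n) k : W *m V = 1%:M ->
  V *m W = 1%:M -> (V *m A *m W) ^+ k = V *m A ^+ k *m W.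
Proof.
move=> WV VW; elim: k => [|k IH]; first by rewrite !expr0 mulmx1.
rewrite !exprS IH -[LHS]/(_ *m _) -[A * _]/(A *m _).
by rewrite !mulmxA -(mulmxA (V *m A) W V) WV mulmx1.
Qed.

Lemma mexp_sum_conj n (V W A : 'M[R[i]]_n) N : W *m V = 1%:M ->
  V *m W = 1%:M -> mexp_sum (V *m A *m W) N = V *m mexp_sum A N *m W.
Proof.
move=> WV VW; rewrite /mexp_sum mulmx_sumr mulmx_suml; apply: eq_bigr => k _.
by rewrite mx_conjX// -scalemxAr -scalemxAl.
Qed.

Lemma mexp_cvg_conj n (V W A E : 'M[R[i]]_n) : W *m V = 1%:M ->
  V *m W = 1%:M -> mx_cvg \oo (mexp_sum A) E ->
  mx_cvg \oo (mexp_sum (V *m A *m W)) (V *m E *m W).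
Proof.
move=> WV VW /(@mx_cvg_mul _ _ _ _ V W); congr mx_cvg; apply/funext => N.
by rewrite mexp_sum_conj.
Qed.

Definition dmx {n : nat} (d : 'I_n -> R[i]) : 'M[R[i]]_n := diag_mx (\row_k d k).

Lemma dmxE n (d : 'I_n -> R[i]) a b : dmx d a b = d a *+ (a == b).
Proof. by rewrite !mxE. Qed.

Lemma dmxX n (d : 'I_n -> R[i]) k : dmx d ^+ k = dmx (fun i => d i ^+ k).
Proof.
elim: k => [|k IH].
  rewrite expr0; apply/matrixP => a b; rewrite dmxE expr0 !mxE//.
rewrite exprS IH -[LHS]/(_ *m _) mul_diag_mx; apply/matrixP => a b.
by rewrite mxE dmxE !mxE mulrnAr exprS.
Qed.

Lemma mexp_cvg_dmx n (d e : 'I_n -> R[i]) :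
  (forall k, complex_cvg \oo (cexp_sum (d k)) (e k)) ->
  mx_cvg \oo (mexp_sum (dmx d)) (dmx e).
Proof.
move=> h a b; rewrite dmxE.
have -> : (fun N => mexp_sum (dmx d) N a b) = (fun N => cexp_sum (d a) N *+ (a == b)).
  apply/funext => N; rewrite /mexp_sum summxE /cexp_sum -sumrMnl.
  by apply: eq_bigr => k _; rewrite mxE dmxX dmxE mulrnAr.
by case: eqP => _; [exact: h|exact: complex_cvg_cst].
Qed.

Definition unitary {n : nat} (V : 'M[R[i]]_n) := ctr V *m V = 1%:M.

Lemma unitary_mul n (V : 'M[R[i]]_n) : unitary V -> V *m ctr V = 1%:M.
Proof. exact: mulmx1C. Qed.

(** The spectral theorem for normal matrices, with the complex eigenvalues replaced by their real
    parts, which are the eigenvalues themselves since [A] is Hermitian. *)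
Lemma herm_spectral n (A : 'M[R[i]]_n) : is_herm A ->
  exists V (d : 'I_n -> R), unitary V /\ A = V *m dmx (fun k => cR (d k)) *m ctr V.
Proof.
move=> hA.
have cE (m p : nat) (B : 'M[R[i]]_(m, p)) : map_mx (@Num.conj_op R[i]) B^T = ctr B.
  by [].
have Ah : (A : 'M[C]_n) \is hermsymmx.
  by apply/is_hermitianmxP; rewrite expr0 scale1r; exact: esym hA.
have /orthomx_spectralP := hermitian_normalmx Ah.
have /mxOverP dr := hermitian_spectral_diag_real Ah.
have uP := spectral_unitarymx (A : 'M[C]_n).
rewrite invmx_unitary//.
move: uP dr; set P := spectralmx _; set sp := spectral_diag _ => uP dr eA.
exists (ctr P), (fun k => complex.Re (sp 0 k)).
have PP : ctr (ctr P) = P.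
  by apply/matrixP => a b; rewrite !mxE conjcK.
split.
  by rewrite /unitary PP; exact/unitarymxP.
rewrite PP {1}eA; congr (_ *m _ *m _).
apply/matrixP => a b; rewrite dmxE !mxE; congr (_ *+ _).
have := dr 0 a; move: (sp 0 a) => z /RRe_real {1}<-.
by [].
Qed.

Lemma mexp_herm n (V : 'M[R[i]]_n) (d : 'I_n -> R) : unitary V ->
  mx_cvg \oo (mexp_sum (V *m dmx (fun k => cR (d k)) *m ctr V))
    (V *m dmx (fun k => cR (expR (d k))) *m ctr V).
Proof.
move=> uV; apply: mexp_cvg_conj => //; first exact: unitary_mul.
by apply: mexp_cvg_dmx => k; exact: cexp_sum_real.
Qed.

Lemma mexp_imag n (V : 'M[R[i]]_n) (d : 'I_n -> R) : unitary V ->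
  mexp (V *m dmx (fun k => iC R * cR (d k)) *m ctr V) =
    V *m dmx (fun k => cis (d k)) *m ctr V.
Proof.
move=> uV; apply: mexpE; apply: mexp_cvg_conj => //; first exact: unitary_mul.
by apply: mexp_cvg_dmx => k; exact: cexp_sum_imag.
Qed.

End MatrixExp.

Arguments mx_cvg {R T n}.
Arguments mexp_sum {R n}.
Arguments dmx {R n}.
Arguments unitary {R n}.

Section ComplexIntegral.
Variable R : realType.
Local Notation mu := (@lebesgue_measure R).

(** Integrability is bundled with the value because additivity of the integral requires it. *)
Definition cintegral_eq (f : R -> R[i]) (l : R[i]) :=
  [/\ mu.-integrable setT (EFin \o (fun t => complex.Re (f t))),
      mu.-integrable setT (EFin \o (fun t => complex.Im (f t))) &
      cintegral f = l].

Lemma cintegral_eqD (f g : R -> R[i]) a b : cintegral_eq f a ->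
  cintegral_eq g b -> cintegral_eq (fun t => f t + g t) (a + b).
Proof.
move=> [f1 f2 fa] [g1 g2 gb].
have eRe : (fun t => complex.Re (f t + g t)) =
    (fun t => complex.Re (f t) + complex.Re (g t)).
  by apply/funext => t; exact: raddfD.
have eIm : (fun t => complex.Im (f t + g t)) =
    (fun t => complex.Im (f t) + complex.Im (g t)).
  by apply/funext => t; exact: raddfD.
split.
- by rewrite eRe; exact: (integrableD measurableT f1 g1).
- by rewrite eIm; exact: (integrableD measurableT f2 g2).
- by rewrite /cintegral eRe eIm !RintegralD// -fa -gb.
Qed.

Lemma cintegral_eq0 : cintegral_eq (fun=> 0) 0.
Proof.
have i0 : mu.-integrable setT (EFin \o (fun=> 0 : R)) by exact: integrable0.
split=> //.
by rewrite /cintegral /= /Rintegral integral0.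
Qed.

Lemma cintegral_eq_sum (I : Type) (s : seq I) (f : I -> R -> R[i]) (l : I -> R[i]) :
  (forall i, cintegral_eq (f i) (l i)) ->
  cintegral_eq (fun t => \sum_(i <- s) f i t) (\sum_(i <- s) l i).
Proof.
move=> h; elim: s => [|i s IH].
  rewrite big_nil (_ : (fun _ => _) = (fun=> 0)); first exact: cintegral_eq0.
  by apply/funext => t; rewrite big_nil.
rewrite big_cons (_ : (fun _ => _) = (fun t => f i t + \sum_(j <- s) f j t)).
  exact: cintegral_eqD.
by apply/funext => t; rewrite big_cons.
Qed.

(** The transform is real because the sine part integrates to 0. *)
Lemma cintegral_tent_cis (c : R[i]) (w : R) :
  cintegral_eq (fun t => c * (cR (tent t) * cis (w * t))) (c * cR (tent_ft w)).
Proof.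
case: c => x y.
pose p (t : R) := tent t * cos (w * t); pose q (t : R) := tent t * sin (w * t).
have ip : mu.-integrable setT (EFin \o p).
  apply: integrable_tentM; last by move=> t; exact: cos_max.
  by apply: continuous_scaled; exact: continuous_cos.
have iq : mu.-integrable setT (EFin \o q).
  apply: integrable_tentM; last by move=> t; exact: sin_max.
  by apply: continuous_scaled; exact: continuous_sin.
have e t : Complex x y * (cR (tent t) * cis (w * t)) =
    Complex (x * p t - y * q t) (x * q t + y * p t).
  by rewrite /cR /cis; simpc; rewrite /p /q.
have iZ (k : R) f : mu.-integrable setT (EFin \o f) ->
    mu.-integrable setT (EFin \o (fun t => k * f t)).
  by move=> fi; exact: (integrableZl measurableT k fi).
have eRe : (fun t => complex.Re (Complex x y * (cR (tent t) * cis (w * t)))) =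
   (fun t => x * p t - y * q t) by apply/funext => t; rewrite e.
have eIm : (fun t => complex.Im (Complex x y * (cR (tent t) * cis (w * t)))) =
   (fun t => x * q t + y * p t) by apply/funext => t; rewrite e.
split.
- by rewrite eRe; exact: (integrableB measurableT (iZ x _ ip) (iZ y _ iq)).
- by rewrite eIm; exact: (integrableD measurableT (iZ x _ iq) (iZ y _ ip)).
rewrite /cintegral eRe eIm RintegralB ?RintegralD//; do ?exact: iZ.
rewrite !RintegralZl// Rintegral_tent_cos Rintegral_tent_sin.
by rewrite /cR; simpc; rewrite ?mulr0 ?subr0 ?add0r ?addr0.
Qed.

End ComplexIntegral.

(** * The derivative of the matrix exponential *)

(** The bookkeeping of [pow_remS]: [t] is the first-order term A^k B and [v] the second-order one,
    both multiplied by their power of the increment. *)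
Lemma addr_cancel (V : zmodType) (p q s t v : V) :
  p - q - (s + t) = p - (q + t) - (s + v) + v.
Proof. by rewrite !opprD !addrA addrNK -!addrA (addrC (- s)). Qed.

Section ExpDerivative.
Variables (R : realType) (n : nat).
Local Notation nc := (@ComplexField.Normc.normc R).
Implicit Types A B : 'M[R[i]]_n.

(** The sum of the moduli is submultiplicative and dominates every entry, which is all that the
    estimates use. *)
Definition mxnorm A : R := \sum_i \sum_j nc (A i j).

Lemma mxnorm_ge0 A : 0 <= mxnorm A.
Proof. by do 2![apply: sumr_ge0 => ? _]; exact: nc_ge0. Qed.

Lemma mxnorm_entry A i j : nc (A i j) <= mxnorm A.
Proof.
rewrite /mxnorm (bigD1 i)//= (bigD1 j)//= -addrA lerDl addr_ge0//.
  by apply: sumr_ge0 => ? _; exact: nc_ge0.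
by do 2![apply: sumr_ge0 => ? _]; exact: nc_ge0.
Qed.

Lemma nc0 : nc 0 = 0.
Proof. exact: ComplexField.Normc.normc0. Qed.

Lemma mxnorm0 : mxnorm 0 = 0.
Proof. by rewrite /mxnorm big1// => i _; rewrite big1// => j _; rewrite mxE nc0. Qed.

Lemma nc_sum (I : Type) (s : seq I) (f : I -> R[i]) :
  nc (\sum_(i <- s) f i) <= \sum_(i <- s) nc (f i).
Proof.
elim: s => [|i s IH]; first by rewrite !big_nil nc0.
by rewrite !big_cons (le_trans (ncD _ _ _))// lerD2l.
Qed.

Lemma ncM (x y : R[i]) : nc (x * y) = nc x * nc y.
Proof. exact: ComplexField.Normc.normcM. Qed.

Lemma mxnormD A B : mxnorm (A + B) <= mxnorm A + mxnorm B.
Proof.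
rewrite /mxnorm -big_split/=; apply: ler_sum => i _.
by rewrite -big_split/=; apply: ler_sum => j _; rewrite mxE ncD.
Qed.

Lemma mxnormZ (c : R[i]) A : mxnorm (c *: A) = nc c * mxnorm A.
Proof.
rewrite /mxnorm mulr_sumr; apply: eq_bigr => i _; rewrite mulr_sumr.
by apply: eq_bigr => j _; rewrite mxE ncM.
Qed.

Lemma mxnormM A B : mxnorm (A *m B) <= mxnorm A * mxnorm B.
Proof.
rewrite {2}/mxnorm mulr_suml; apply: ler_sum => i _; rewrite mulr_suml.
apply: (@le_trans _ _ (\sum_j \sum_k nc (A i k) * nc (B k j))).
  apply: ler_sum => j _; rewrite mxE (le_trans (nc_sum _ _ _))//.
  by apply: ler_sum => k _; rewrite ncM.
rewrite exchange_big/=; apply: ler_sum => k _.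
rewrite -mulr_sumr ler_wpM2l ?nc_ge0// /mxnorm [leRHS](bigD1 k)//= lerDl.
by do 2![apply: sumr_ge0 => ? _]; exact: nc_ge0.
Qed.

(* The derivative of (A + hB)^k at h = 0, i.e. \sum_(i < k) A^i B A^(k-1-i) *)
Fixpoint dpow A B (k : nat) : 'M[R[i]]_n :=
  if k is k'.+1 then dpow A B k' *m A + A ^+ k' *m B else 0.

Definition pow_rem A B (h : R) (k : nat) : 'M[R[i]]_n :=
  (A + cR h *: B) ^+ k - A ^+ k - cR h *: dpow A B k.

Lemma pow_remS A B h k : pow_rem A B h k.+1 =
  pow_rem A B h k *m (A + cR h *: B) + cR (h ^+ 2) *: (dpow A B k *m B).
Proof.
rewrite /pow_rem /= [(A + _) ^+ _]exprSr [A ^+ _]exprSr.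
rewrite -[_ ^+ k * (A + _)]/(_ *m _) -[A ^+ k * A]/(_ *m _).
rewrite rmorphXn/= [_ ^+ 2]expr2.
move: ((A + cR h *: B) ^+ k) => X; move: (A ^+ k) (dpow A B k) (cR h) => Y D c.
rewrite !mulmxBl (mulmxDr Y) (mulmxDr (c *: D)) -(scalemxAr c Y B).
rewrite -(scalemxAl c D A) -(scalemxAr c (c *: D) B) -(scalemxAl c D B) scalerA.
rewrite scalerDr.
exact: addr_cancel.
Qed.

Lemma mxnorm_powM A B (M : R) k : 0 <= M -> mxnorm A <= M -> mxnorm B <= M ->
  mxnorm (A ^+ k *m B) <= M ^+ k.+1.
Proof.
move=> M0 AM BM; elim: k => [|k IH]; first by rewrite expr0 mul1mx expr1.
rewrite [A ^+ _]exprS -[A * _]/(A *m _) -mulmxA (le_trans (mxnormM _ _))//.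
by rewrite [M ^+ _]exprS ler_pM ?mxnorm_ge0.
Qed.

Lemma mxnorm_dpow A B (M : R) k : 0 <= M -> mxnorm A <= M -> mxnorm B <= M ->
  mxnorm (dpow A B k) <= (2 * M) ^+ k.
Proof.
move=> M0 AM BM; elim: k => [|k IH].
  by rewrite /= expr0 mxnorm0 ler01.
rewrite /= (le_trans (mxnormD _ _))//.
apply: (@le_trans _ _ ((2 * M) ^+ k * M + M ^+ k.+1)).
  rewrite lerD ?mxnorm_powM// (le_trans (mxnormM _ _))//.
  by rewrite ler_pM ?mxnorm_ge0.
have h : M ^+ k <= (2 * M) ^+ k by rewrite lerXn2r ?nnegrE ?mulr_ge0//; lra.
by rewrite !exprSr; nra.
Qed.

(** Growing the base absorbs the polynomial factors in [k]: [2 * M] pays for the k summands of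
    [dpow], [3 * M] for accumulating these in the recursion [pow_remS]. The bound stays geometric,
    so dividing by k! and summing gives an exponential. *)
Lemma mxnorm_pow_rem A B (M h : R) k : `|h| <= 1 -> mxnorm A + mxnorm B <= M ->
  mxnorm (pow_rem A B h k) <= h ^+ 2 * (3 * M) ^+ k.
Proof.
move=> h1 ABM.
have A0 := mxnorm_ge0 A; have B0 := mxnorm_ge0 B.
have M0 : 0 <= M by lra.
have AhB : mxnorm (A + cR h *: B) <= M.
  rewrite (le_trans (mxnormD _ _))// mxnormZ ncR.
  by have := ler_piMl B0 h1; lra.
elim: k => [|k IH].
  by rewrite /pow_rem /= subrr scaler0 subrr mulr1 mxnorm0 sqr_ge0.
rewrite pow_remS (le_trans (mxnormD _ _))//.
apply: (@le_trans _ _ (h ^+ 2 * (3 * M) ^+ k * M + h ^+ 2 * ((2 * M) ^+ k * M))).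
  rewrite lerD//.
    by rewrite (le_trans (mxnormM _ _))// ler_pM ?mxnorm_ge0.
  rewrite mxnormZ ncR ger0_norm ?sqr_ge0// ler_wpM2l ?sqr_ge0//.
  rewrite (le_trans (mxnormM _ _))// ler_pM ?mxnorm_ge0 ?mxnorm_dpow//; lra.
have h2 : 0 <= h ^+ 2 by exact: sqr_ge0.
have h3 : (2 * M) ^+ k <= (3 * M) ^+ k by rewrite lerXn2r ?nnegrE ?mulr_ge0//; lra.
have h4 : (2 * M) ^+ k * M <= (3 * M) ^+ k * M by rewrite ler_wpM2r.
have h5 : 0 <= (3 * M) ^+ k * M by rewrite mulr_ge0// exprn_ge0// mulr_ge0.
rewrite -mulrA -mulrDr ler_wpM2l// exprSr; lra.
Qed.

Definition dexp_sum A B (N : nat) : 'M[R[i]]_n := \sum_(k < N) (k`!%:R)^-1 *: dpow A B k.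

Lemma exp_partial_le (M : R) N : 0 <= M -> \sum_(k < N) (k`!%:R)^-1 * M ^+ k <= expR M.
Proof.
move=> M0.
have -> : \sum_(k < N) (k`!%:R)^-1 * M ^+ k = series (exp_coeff M) N.
  by rewrite /series/= big_mkord; apply: eq_bigr => k _; rewrite mulrC.
apply: nondecreasing_cvgn_le; last exact: is_cvg_series_exp_coeff.
apply/nondecreasing_seqP => m; rewrite /series/= big_nat_recr//= lerDl.
exact: exp_coeff_ge0.
Qed.

Lemma mexp_diff_bound A B (M h : R) N a b : `|h| <= 1 -> mxnorm A + mxnorm B <= M ->
  nc (mexp_sum (A + cR h *: B) N a b - mexp_sum A N a b - cR h * dexp_sum A B N a b)
  <= h ^+ 2 * expR (3 * M).
Proof.
move=> h1 ABM.
have M0 : 0 <= M by have := mxnorm_ge0 A; have := mxnorm_ge0 B; lra.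
have -> : mexp_sum (A + cR h *: B) N a b - mexp_sum A N a b - cR h * dexp_sum A B N a b
    = \sum_(k < N) (k`!%:R)^-1 * pow_rem A B h k a b.
  rewrite /mexp_sum /dexp_sum !summxE mulr_sumr -!sumrB; apply: eq_bigr => k _.
  by rewrite /pow_rem !mxE !mulrBr [cR h * _]mulrCA.
rewrite (le_trans (nc_sum _ _ _))//.
apply: (@le_trans _ _ (\sum_(k < N) h ^+ 2 * ((k`!%:R)^-1 * (3 * M) ^+ k))); last first.
  by rewrite -mulr_sumr ler_wpM2l ?sqr_ge0// exp_partial_le// mulr_ge0.
apply: ler_sum => k _; rewrite ncM mulrCA.
have -> : nc (k`!%:R)^-1 = (k`!%:R)^-1.
  rewrite (_ : (k`!%:R)^-1 = cR (k`!%:R)^-1); last by rewrite fmorphV rmorph_nat.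
  by rewrite ncR ger0_norm// invr_ge0.
rewrite ler_wpM2l ?invr_ge0//.
by rewrite (le_trans (mxnorm_entry _ _ _))// mxnorm_pow_rem.
Qed.

Lemma complex_lim_le (f : nat -> R[i]) (l : R[i]) (K : R) :
  complex_cvg \oo f l -> (forall N, nc (f N) <= K) -> nc l <= K.
Proof.
move=> /complex_cvgP/cvgr0Pnorm_lt fl fK; apply/ler_addgt0Pr => e e0.
have [N _ /(_ N (leqnn N))/=] := fl _ e0.
rewrite ger0_norm ?nc_ge0// => h.
have -> : l = f N - (f N - l) by rewrite opprB addrC subrK.
have := @ncD R (f N) (- (f N - l)); rewrite ncN => h'.
by apply: le_trans h' _; rewrite lerD// ltW.
Qed.

(** The estimate [mexp_diff_bound] does not involve [N], so it survives the limit in [N]; dividing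
    by h then leaves an error of order h. *)
Lemma mexp_quotient_cvg A B (E : R -> 'M[R[i]]_n) (D : 'M[R[i]]_n) a b :
  (forall h, mx_cvg \oo (mexp_sum (A + cR h *: B)) (E h)) ->
  mx_cvg \oo (dexp_sum A B) D ->
  complex_cvg (0 : R)^' (fun h => (E h a b - E 0 a b) / cR h) (D a b).
Proof.
move=> cE cD.
pose M := mxnorm A + mxnorm B; pose K := expR (3 * M).
have bnd h : `|h| <= 1 -> nc (E h a b - E 0 a b - cR h * D a b) <= h ^+ 2 * K.
  move=> h1.
  apply: (@complex_lim_le (fun N => mexp_sum (A + cR h *: B) N a b - mexp_sum A N a b
     - cR h * dexp_sum A B N a b)).
    have c0 : mx_cvg \oo (mexp_sum A) (E 0).
      by have := cE 0; rewrite rmorph0 scale0r addr0.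
    apply: complex_cvgB; first by apply: complex_cvgB; [exact: cE|exact: c0].
    by apply: complex_cvgMr; exact: cD.
  by move=> N; exact: mexp_diff_bound.
apply/complex_cvgP; apply: (@squeeze_cvgr _ _ _ _ (cst 0) (fun h : R => `|h| * K)).
- near=> h; rewrite /= nc_ge0/=.
  have h0 : h != 0 by near: h; exact: nbhs_dnbhs_neq.
  have h1 : `|h| <= 1.
    near: h; apply: dnbhs0_le; exact: ltr01.
  have ch : cR h != 0 :> R[i] by rewrite fmorph_eq0.
  have -> : (E h a b - E 0 a b) / cR h - D a b =
    (E h a b - E 0 a b - cR h * D a b) * cR h^-1.
    by rewrite fmorphV; field.
  rewrite ncM ncR normfV ler_pdivrMr ?normr_gt0// mulrAC -expr2.
  by rewrite real_normK ?num_real// bnd.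
- exact: cvg_cst.
- rewrite -[X in _ --> X](mul0r K); apply: cvgMl.
  have : (fun h : R => `|h|) @ (0 : R)^' --> (`|0 : R| : R).
    by apply: cvg_norm; exact: nbhs_dnbhs.
  by rewrite normr0.
Unshelve. all: by end_near. Qed.

Definition divdiff_exp (x y : R) : R :=
  if x == y then expR x else (expR x - expR y) / (x - y).

Fixpoint dpow_scal (x y : R) (k : nat) : R :=
  if k is k'.+1 then dpow_scal x y k' * y + x ^+ k' else 0.

(** For diagonal A, the matrix A^i B A^j has entries x_a^i B_ab x_b^j; [dpow_scal] is the sum of
    these weights over i + j = k - 1. *)
Lemma dpow_dmx (x : 'I_n -> R) B k a b :
  dpow (dmx (fun i => cR (x i))) B k a b = cR (dpow_scal (x a) (x b) k) * B a b.
Proof.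
elim: k => [|k IH] /=; first by rewrite rmorph0 mul0r mxE.
rewrite mxE dmxX /dmx mul_mx_diag mul_diag_mx 2![in LHS]mxE [X in _ + X]mxE IH.
by rewrite !mxE rmorphD rmorphM rmorphXn/=; ring.
Qed.

Lemma dpow_scalB x y k : (x - y) * dpow_scal x y k = x ^+ k - y ^+ k.
Proof.
elim: k => [|k IH]; first by rewrite /= mulr0 !expr0 subrr.
by rewrite /= mulrDr mulrA IH !exprSr; ring.
Qed.

Lemma dpow_scal_diag x k : dpow_scal x x k = k%:R * x ^+ k.-1.
Proof.
elim: k => [|k IH]; first by rewrite /= mul0r.
rewrite /= IH -natr1; case: k {IH} => [|k] /=; first by rewrite !mul0r mulr1 !add0r.
by rewrite exprSr; ring.
Qed.

Lemma divdiff_cvg (x y : R) :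
  (fun N => \sum_(k < N) (k`!%:R)^-1 * dpow_scal x y k) @ \oo --> divdiff_exp x y.
Proof.
have ex (z : R) : (fun N => \sum_(k < N) (k`!%:R)^-1 * z ^+ k) @ \oo --> expR z.
  have -> : (fun N => \sum_(k < N) (k`!%:R)^-1 * z ^+ k) = series (exp_coeff z).
    apply/funext => N; rewrite /series/= big_mkord.
    by apply: eq_bigr => k _; rewrite mulrC.
  exact: is_cvg_series_exp_coeff.
rewrite /divdiff_exp; case: eqP => [<-|/eqP xy].
  (* The term [k = 0] vanishes, and (k + 1) / (k + 1)! = 1 / k! turns the shifted sum into the
     exponential series. *)
  rewrite -(cvg_shiftS (fun N => \sum_(k < N) (k`!%:R)^-1 * dpow_scal x x k)).
  apply: cvg_trans (ex x); rewrite (_ : (fun _ => _) =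
    (fun N => \sum_(k < N) (k`!%:R)^-1 * x ^+ k)) //.
  apply/funext => N; rewrite big_ord_recl/= mulr0 add0r; apply: eq_bigr => k _.
  rewrite -[dpow_scal x x k * x + _]/(dpow_scal x x k.+1) dpow_scal_diag /bump /= add1n factS natrM.
  have k0 : k.+1%:R != 0 :> R by rewrite pnatr_eq0.
  have f0 : k`!%:R != 0 :> R by rewrite pnatr_eq0 -lt0n fact_gt0.
  by move: (k.+1%:R) k0 (k`!%:R) f0 => p p0 q q0; field; rewrite p0 q0.
have xy0 : x - y != 0 by rewrite subr_eq0.
rewrite (_ : (fun _ => _) = (fun N => (\sum_(k < N) (k`!%:R)^-1 * x ^+ k -
   \sum_(k < N) (k`!%:R)^-1 * y ^+ k) / (x - y))).
  by apply: cvgMl; apply: cvgB; exact: ex.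
apply/funext => N; rewrite -sumrB mulr_suml; apply: eq_bigr => k _.
by rewrite -mulrBr -dpow_scalB -[RHS]mulrA; congr (_ * _); rewrite mulrAC divff ?mul1r.
Qed.

Lemma dexp_cvg_dmx (x : 'I_n -> R) B :
  mx_cvg \oo (dexp_sum (dmx (fun i => cR (x i))) B)
    (\matrix_(a, b) (cR (divdiff_exp (x a) (x b)) * B a b)).
Proof.
move=> a b; rewrite mxE.
rewrite (_ : (fun _ => _) =
  (fun N => cR (\sum_(k < N) (k`!%:R)^-1 * dpow_scal (x a) (x b) k) * B a b)).
  by apply: complex_cvgMl; apply: complex_cvg_real; exact: divdiff_cvg.
apply/funext => N; rewrite /dexp_sum summxE rmorph_sum mulr_suml.
apply: eq_bigr => k _.
by rewrite mxE dpow_dmx rmorphM/= fmorphV rmorph_nat mulrA.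
Qed.

End ExpDerivative.

Arguments dexp_sum {R n}.
Arguments divdiff_exp {R}.

(** * The Lyapunov equation *)

Section Hermitian.
Variables (R : realType) (n : nat).
Implicit Types A B U V W : 'M[R[i]]_n.

Lemma ctrD A B : ctr (A + B) = ctr A + ctr B.
Proof. by apply/matrixP => a b; rewrite !mxE rmorphD. Qed.

Lemma ctrN A : ctr (- A) = - ctr A.
Proof. by apply/matrixP => a b; rewrite !mxE rmorphN. Qed.

Lemma ctrZR (x : R) A : ctr (cR x *: A) = cR x *: ctr A.
Proof.
apply/matrixP => a b; rewrite !mxE rmorphM; congr (_ * _).
by rewrite /cR /= oppr0.
Qed.

Lemma hermN A : is_herm A -> is_herm (- A).
Proof. by rewrite /is_herm ctrN => ->. Qed.

Lemma hermD A B : is_herm A -> is_herm B -> is_herm (A + B).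
Proof. by rewrite /is_herm ctrD => -> ->. Qed.

Lemma hermZR (x : R) A : is_herm A -> is_herm (cR x *: A).
Proof. by rewrite /is_herm ctrZR => ->. Qed.

Lemma herm0 : is_herm (0 : 'M[R[i]]_n).
Proof. by apply/matrixP => a b; rewrite !mxE rmorph0. Qed.

Lemma trace_conj V A : unitary V -> \tr (V *m A *m ctr V) = \tr A.
Proof. by move=> uV; rewrite mxtrace_mulC mulmxA uV mul1mx. Qed.

Lemma sum_expR_gt0 (d : 'I_n -> R) : (0 < n)%N -> 0 < \sum_k expR (d k).
Proof.
move=> n0; rewrite (bigD1 (Ordinal n0))//= ltr_pwDl ?expR_gt0//.
by apply: sumr_ge0 => k _; exact: expR_ge0.
Qed.

Lemma trace_dmx_conj V (d : 'I_n -> R[i]) : unitary V ->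
  \tr (V *m dmx d *m ctr V) = \sum_k d k.
Proof.
move=> uV; rewrite trace_conj// /mxtrace.
by apply: eq_bigr => k _; rewrite dmxE eqxx.
Qed.

Lemma herm_mexp_cvg A : is_herm A -> mx_cvg \oo (mexp_sum A) (mexp A).
Proof.
move=> /herm_spectral[V [d [uV ->]]]; rewrite (mexpE _ _ _ _ (mexp_herm _ _ V d uV)).
exact: mexp_herm.
Qed.

Lemma herm_mexp_trace_neq0 A : is_herm A -> (0 < n)%N -> \tr (mexp A) != 0.
Proof.
move=> /herm_spectral[V [d [uV ->]]] n0; rewrite (mexpE _ _ _ _ (mexp_herm _ _ V d uV)).
by rewrite trace_dmx_conj// -rmorph_sum fmorph_eq0 gt_eqF// sum_expR_gt0.
Qed.

Lemma unitary_conjM V A B : unitary V ->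
  V *m A *m ctr V *m (V *m B *m ctr V) = V *m (A *m B) *m ctr V.
Proof.
move=> uV; rewrite -!mulmxA; congr (_ *m (_ *m _)).
by rewrite mulmxA uV mul1mx.
Qed.

Lemma ket_bra_mul U (horth : forall k l, bra U k *m ket U l = ((k == l)%:R)%:M) k l :
  ket U k *m bra U k *m (ket U l *m bra U l) =
    (k == l)%:R *: (ket U k *m bra U k).
Proof.
rewrite -mulmxA (mulmxA (bra U k)) horth mul_scalar_mx -scalemxAr.
by case: eqP => [->//|_]; rewrite !scale0r.
Qed.

(** Orthonormality says that [ctr U] is a left inverse of [U]; for a square matrix it is also a
    right inverse, which is completeness. *)
Lemma ket_bra_sum U (horth : forall k l, bra U k *m ket U l = ((k == l)%:R)%:M) :
  \sum_k ket U k *m bra U k = 1%:M.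
Proof.
have uU : unitary U.
  apply/matrixP => k l; have /matrixP/(_ 0 0) := horth k l.
  rewrite !mxE eqxx mulr1n => <-; apply: eq_bigr => m _.
  by rewrite !mxE.
rewrite -(unitary_mul _ _ _ uU); apply/matrixP => a b; rewrite summxE !mxE.
by apply: eq_bigr => k _; rewrite !mxE big_ord1 !mxE.
Qed.

(* In the eigenbasis of [rho] the entries of the Lyapunov equation determine [X],
   since [lam k + lam l != 0]. *)
Lemma SLD_lyapunov U (lam : 'I_n -> R) (rho D X : 'M[R[i]]_n)
    (horth : forall k l, bra U k *m ket U l = ((k == l)%:R)%:M)
    (hdec : rho = \sum_k cR (lam k) *: (ket U k *m bra U k))
    (hlam : forall k, 0 < lam k)
    (hX : rho *m X + X *m rho = 2 *: D) :
  SLD U lam D = X.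
Proof.
pose P k := ket U k *m bra U k.
have Prho k : P k *m rho = cR (lam k) *: P k.
  rewrite hdec mulmx_sumr (bigD1 k)//= -scalemxAr ket_bra_mul// eqxx scale1r.
  rewrite big1 ?addr0// => l lk.
  by rewrite -scalemxAr ket_bra_mul// eq_sym (negbTE lk) scale0r scaler0.
have rhoP k : rho *m P k = cR (lam k) *: P k.
  rewrite hdec mulmx_suml (bigD1 k)//= -scalemxAl ket_bra_mul// eqxx scale1r.
  rewrite big1 ?addr0// => l lk.
  by rewrite -scalemxAl ket_bra_mul// (negbTE lk) scale0r scaler0.
(* Sandwiching the Lyapunov equation gives 2 P_k D P_l = (lam_k + lam_l) P_k X P_l; completeness
   then sums the blocks back to [X]. *)
have term k l : (2 / cR (lam k + lam l)) *:
   (ket U k *m bra U k *m D *m ket U l *m bra U l) = P k *m X *m P l.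
  rewrite -(mulmxA _ (ket U l)) -/(P k) -/(P l).
  have s0 : cR (lam k + lam l) != 0 :> R[i].
    by rewrite fmorph_eq0 gt_eqF// addr_gt0.
  rewrite mulrC -scalerA (scalemxAl 2) (scalemxAr 2) -hX mulmxDr mulmxDl.
  rewrite (mulmxA (P k) rho X) Prho -(mulmxA (P k) (X *m rho)) -(mulmxA X rho) rhoP.
  rewrite -!scalemxAl -!scalemxAr (mulmxA (P k) X).
  by rewrite -scalerDl -rmorphD scalerA mulVf// scale1r.
rewrite /SLD; under eq_bigr do under eq_bigr do rewrite term.
under eq_bigr do rewrite -mulmx_sumr ket_bra_sum// mulmx1.
by rewrite -mulmx_suml ket_bra_sum// mul1mx.
Qed.

(** The vector [ctr V *m ket U k] is a nonzero eigenvector of a diagonal matrix, so at any nonzero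
    coordinate [p] the eigenvalue [lam k] equals [r p]. *)
Lemma eigenvalue_gt0 U V (lam r : 'I_n -> R) (rho : 'M[R[i]]_n)
    (horth : forall k l, bra U k *m ket U l = ((k == l)%:R)%:M)
    (hdec : rho = \sum_k cR (lam k) *: (ket U k *m bra U k))
    (uV : unitary V) (r0 : forall k, 0 < r k)
    (hV : rho = V *m dmx (fun k => cR (r k)) *m ctr V) k : 0 < lam k.
Proof.
have rk : rho *m ket U k = cR (lam k) *: ket U k.
  rewrite hdec mulmx_suml (bigD1 k)//= -scalemxAl -mulmxA horth eqxx mulmx1.
  rewrite big1 ?addr0// => l lk.
  by rewrite -scalemxAl -mulmxA horth (negbTE lk) mul_mx_scalar scale0r scaler0.
pose w := ctr V *m ket U k.
have wE : dmx (fun k => cR (r k)) *m w = cR (lam k) *: w.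
  by rewrite /w scalemxAr -rk hV !mulmxA uV mul1mx.
have w0 : w != 0.
  apply/eqP => w0; have : ket U k = 0.
    by rewrite -[ket U k]mul1mx -(unitary_mul _ _ _ uV) -mulmxA -/w w0 mulmx0.
  move=> k0; have /matrixP/(_ 0 0) := horth k k.
  rewrite k0 mulmx0 !mxE !eqxx mulr1n => /eqP.
  by rewrite eq_sym oner_eq0.
have [p wp] : exists p, w p 0 != 0.
  apply/existsP; apply: contraNT w0 => /existsPn h.
  by apply/eqP/matrixP => a b; rewrite ord1 [RHS]mxE; have := h a; rewrite negbK => /eqP.
move: wE wp; move: (w) => w' wE wp.
have /matrixP/(_ p 0) := wE.
rewrite mul_diag_mx !mxE => /(mulIf wp) /(congr1 (@complex.Re R)) /= <-.
exact: r0.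
Qed.

End Hermitian.

(** The (p, q) entry of the Lyapunov equation as a scalar identity: [a], [b] are eigenvalues of
    [rho], [f] the transform, [dv] the divided difference, [z] the partition function, and [e] tests
    p = q. *)
Lemma lyapunov_entry (F : fieldType) (a b f g tau z dv : F) (e : bool) : z != 0 ->
  (a + b) * f = 2 * z^-1 * dv -> (e -> a = b) ->
  a * (- (f * g) + tau *+ e) + (- (f * g) + tau *+ e) * b =
  2 * (z^-1 * (dv * - g - - (z * tau) * (a *+ e))).
Proof.
move=> z0 key ab.
transitivity (- ((a + b) * f) * g + (a + b) * (tau *+ e)); first by ring.
rewrite key; case: e ab => [<-//|_]; rewrite ?mulr1n ?mulr0n; field; exact: z0.
Qed.

(** A quotient rule in which the moving denominator is written [z + h t(h)], with [t] its difference
    quotient, so that its continuity at 0 comes for free. *)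
Lemma quotient_cvg (R : realType) (q t : R -> R[i]) (D T z w : R[i]) :
  z != 0 -> complex_cvg (0 : R)^' q D -> complex_cvg (0 : R)^' t T ->
  complex_cvg (0 : R)^' (fun h => (z + cR h * t h)^-1 * (q h - t h * w))
    (z^-1 * (D - T * w)).
Proof.
move=> z0 qD tT.
have hc : complex_cvg (0 : R)^' (fun h : R => cR h) (cR 0).
  by apply: complex_cvg_real; exact: nbhs_dnbhs.
apply: complex_cvgM; last by apply: complex_cvgB => //; exact: complex_cvgMl.
apply: complex_cvgV => //.
have e : z + cR 0 * T = z by rewrite rmorph0 mul0r addr0.
rewrite -[X in complex_cvg _ _ X]e; apply: complex_cvgD; first exact: complex_cvg_cst.
exact: complex_cvgM.
Qed.

Lemma quotient_entry (F : fieldType) (x y zh z c : F) : zh != 0 -> z != 0 -> c != 0 ->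
  zh^-1 * ((x - y) / c - (zh - z) / c * (z^-1 * y)) = c^-1 * (zh^-1 * x - z^-1 * y).
Proof. by move=> zh0 z0 c0; field; rewrite zh0 z0 c0. Qed.

Lemma normalized_quotient_cvg (R : realType) (n : nat) (E : R -> 'M[R[i]]_n)
    (D : 'M[R[i]]_n) :
  (forall p r, complex_cvg (0 : R)^' (fun h => (E h p r - E 0 p r) / cR h) (D p r)) ->
  (forall s, \tr (E s) != 0) ->
  mx_cvg (0 : R)^'
    (fun h => (cR h)^-1 *: ((\tr (E h))^-1 *: E h - (\tr (E 0))^-1 *: E 0))
    ((\tr (E 0))^-1 *: (D - \tr D *: ((\tr (E 0))^-1 *: E 0))).
Proof.
move=> qc tE0 p r.
pose t (h : R) : R[i] := \sum_i (E h i i - E 0 i i) / cR h.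
have tc : complex_cvg (0 : R)^' t (\tr D) by apply: complex_cvg_sum => i; exact: qc.
have tE (h : R) : t h = (\tr (E h) - \tr (E 0)) / cR h.
  by rewrite /t -mulr_suml sumrB.
have := quotient_cvg _ _ _ _ _ _ ((\tr (E 0))^-1 * E 0 p r) (tE0 0) (qc p r) tc.
have -> : (\tr (E 0))^-1 * (D p r - \tr D * ((\tr (E 0))^-1 * E 0 p r)) =
    ((\tr (E 0))^-1 *: (D - \tr D *: ((\tr (E 0))^-1 *: E 0))) p r.
  by rewrite !mxE.
apply: complex_cvg_near; near=> h.
have h0 : h != 0 by near: h; exact: nbhs_dnbhs_neq.
have ch : cR h != 0 :> R[i] by rewrite fmorph_eq0.
have -> : \tr (E 0) + cR h * t h = \tr (E h).
  by rewrite tE mulrC divfK// addrC subrK.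
by rewrite tE quotient_entry// !mxE.
Unshelve. all: by end_near. Qed.

(** * The state, its derivative and the channel in an eigenbasis of [Gth] *)

Section QuantumState.
Variables (R : realType) (n J : nat) (G : 'I_J -> 'M[R[i]]_n).
Hypothesis hG : forall j, is_herm (G j).

Lemma Gth_herm th : is_herm (Gth G th).
Proof.
rewrite /Gth; elim/big_ind: _ => [|A B|k _]; [exact: herm0|exact: hermD|].
exact/hermZR/hG.
Qed.

Definition shift (th : 'I_J -> R) (j : 'I_J) (s : R) : 'I_J -> R :=
  fun i => th i + (if i == j then s else 0).

Lemma Gth_shift th j s : Gth G (shift th j s) = Gth G th + cR s *: G j.
Proof.
rewrite /Gth (bigD1 j)//= [in RHS](bigD1 j)//= /shift eqxx rmorphD scalerDl.
rewrite -!addrA; congr (_ + _); rewrite addrC; congr (_ + _).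
by apply: eq_bigr => i /negbTE ->; rewrite addr0.
Qed.

Variables (th : 'I_J -> R) (j : 'I_J) (V : 'M[R[i]]_n) (d : 'I_n -> R).
Hypotheses (uV : unitary V)
  (GV : Gth G th = V *m dmx (fun k => cR (d k)) *m ctr V).

Let g := ctr V *m G j *m V.
Let Z : R := \sum_k expR (- d k).

Let Vu : V *m ctr V = 1%:M. Proof. exact: unitary_mul. Qed.

Lemma GjE : G j = V *m g *m ctr V.
Proof. by rewrite /g !mulmxA Vu mul1mx -mulmxA Vu mulmx1. Qed.

Lemma mexp_Gth : mexp (- Gth G th) = V *m dmx (fun k => cR (expR (- d k))) *m ctr V.
Proof.
rewrite GV.
have -> : - (V *m dmx (fun k => cR (d k)) *m ctr V) =
    V *m dmx (fun k => cR (- d k)) *m ctr V.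
  rewrite -mulNmx -mulmxN; congr (_ *m _ *m _).
  by apply/matrixP => a b; rewrite mxE !dmxE rmorphN mulNrn.
exact: mexpE (mexp_herm _ _ V (fun k => - d k) uV).
Qed.

Lemma rhoE : rho G th = V *m dmx (fun k => cR (expR (- d k) / Z)) *m ctr V.
Proof.
rewrite /rho mexp_Gth trace_dmx_conj// -rmorph_sum -/Z scalemxAl scalemxAr.
congr (_ *m _ *m _); apply/matrixP => a b; rewrite mxE !dmxE mulrnAr.
by rewrite rmorphM/= fmorphV mulrC.
Qed.

Lemma Z_gt0 : (0 < n)%N -> 0 < Z.
Proof.
exact: sum_expR_gt0.
Qed.

Definition dmexp : 'M[R[i]]_n :=
  \matrix_(p, q) (cR (divdiff_exp (- d p) (- d q)) * (- g p q)).

Definition drho : 'M[R[i]]_n :=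
  (cR Z)^-1 *: (dmexp - \tr dmexp *: dmx (fun k => cR (expR (- d k) / Z))).

Lemma pderiv_rho : pderiv (rho G) th j = V *m drho *m ctr V.
Proof.
apply/matrixP => a b; rewrite mxE.
(* The index [a] witnesses that the space is nonzero; in dimension 0 the trace would vanish. *)
have n0 : (0 < n)%N by apply: leq_ltn_trans (ltn_ord a).
have Z0 : cR Z != 0 :> R[i] by rewrite fmorph_eq0 gt_eqF// Z_gt0.
pose X s := - Gth G (shift th j s).
have hX s : is_herm (X s) by exact/hermN/Gth_herm.
pose E s := ctr V *m mexp (X s) *m V.
pose A := dmx (fun k => cR (- d k)).
have XE s : ctr V *m X s *m V = A + cR s *: (- g).
  rewrite /X Gth_shift GV opprD mulmxDr mulmxDl; congr (_ + _).
    rewrite mulmxN mulNmx !mulmxA uV mul1mx -mulmxA uV mulmx1.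
    by apply/matrixP => p q; rewrite mxE !dmxE rmorphN mulNrn.
  by rewrite mulmxN mulNmx -scalemxAr -scalemxAl scalerN.
(* For general [s] the matrix is not diagonal in this basis; the series converges because [X s] is
   Hermitian, hence diagonal in some other one. *)
have cE s : mx_cvg \oo (mexp_sum (A + cR s *: (- g))) (E s).
  by rewrite -XE; apply: mexp_cvg_conj => //; exact: herm_mexp_cvg.
have EX s : mexp (X s) = V *m E s *m ctr V.
  by rewrite /E !mulmxA Vu mul1mx -mulmxA Vu mulmx1.
have trE s : \tr (mexp (X s)) = \tr (E s).
  by rewrite EX trace_conj.
have tE0 s : \tr (E s) != 0 by rewrite -trE; exact: herm_mexp_trace_neq0.
have E0 : E 0 = dmx (fun k => cR (expR (- d k))).
  have X0 : X 0 = - Gth G th by rewrite /X Gth_shift rmorph0 scale0r addr0.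
  by rewrite /E X0 mexp_Gth !mulmxA uV mul1mx -mulmxA uV mulmx1.
have trE0 : \tr (E 0) = cR Z.
  by rewrite E0 /mxtrace rmorph_sum; apply: eq_bigr => k _; rewrite dmxE eqxx.
have qc p r : complex_cvg (0 : R)^' (fun h => (E h p r - E 0 p r) / cR h) (dmexp p r).
  apply: (@mexp_quotient_cvg R n A (- g) E dmexp) => //.
  have -> : dmexp = \matrix_(p, q) (cR (divdiff_exp (- d p) (- d q)) * (- g) p q).
    by apply/matrixP => p' r'; rewrite !mxE.
  exact: dexp_cvg_dmx.
pose Q s : 'M[R[i]]_n := (\tr (E s))^-1 *: E s.
have Qc : mx_cvg (0 : R)^' (fun h : R => (cR h)^-1 *: (Q h - Q 0)) drho.
  have -> : drho = (\tr (E 0))^-1 *: (dmexp - \tr dmexp *: Q 0).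
    rewrite /drho /Q trE0; congr (_ *: (_ - _ *: _)); rewrite E0.
    apply/matrixP => p r; rewrite dmxE [RHS]mxE dmxE mulrnAr.
    by rewrite rmorphM/= fmorphV mulrC.
  exact: normalized_quotient_cvg.
apply: complex_lim.
have VQ : mx_cvg (0 : R)^' (fun h : R => V *m ((cR h)^-1 *: (Q h - Q 0)) *m ctr V)
    (V *m drho *m ctr V) by exact: mx_cvg_mul.
have rQ s : rho G (fun i => th i + (if i == j then s else 0)) = V *m Q s *m ctr V.
  by rewrite /rho -/(shift th j s) -/(X s) trE EX /Q -scalemxAr -scalemxAl.
have entry (c : R[i]) (P P' : 'M[R[i]]_n) : (c *: (P - P')) a b = (P a b - P' a b) * c.
  by rewrite !mxE mulrC.
have := VQ a b; congr complex_cvg; apply/funext => h.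
by rewrite add0r !rQ -scalemxAr -scalemxAl mulmxBr mulmxBl entry.
Qed.

(** In the eigenbasis, conjugation by the evolution multiplies the (p, q) entry by the phase exp (i
    (d_q - d_p) t). Each entry in the original basis is a finite combination of such phases. *)
Lemma PhiE : Phi G th (G j) =
  V *m (\matrix_(p, q) (cR (tent_ft (d q - d p)) * g p q)) *m ctr V.
Proof.
apply/matrixP => a b; rewrite mxE.
have mi (s : R) : mexp ((iC R * cR s) *: Gth G th) =
    V *m dmx (fun k => cis (s * d k)) *m ctr V.
  rewrite -(mexp_imag _ _ V (fun k => s * d k) uV); congr mexp.
  rewrite GV scalemxAl scalemxAr; congr (_ *m _ *m _).
  by apply/matrixP => p q; rewrite mxE !dmxE rmorphM mulrnAr mulrA.
have cisD x y : cis x * cis y = cis (x + y) :> R[i].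
  by rewrite /cis cosD sinD; simpc; congr Complex; ring.
pose c (p q : 'I_n) := V a p * g p q * ctr V q b.
have [_ _] : cintegral_eq R (fun t => \sum_p \sum_q c p q * (cR (tent t) * cis ((d q - d p) * t)))
   (\sum_p \sum_q c p q * cR (tent_ft (d q - d p))).
  by do 2![apply: cintegral_eq_sum => ?]; exact: cintegral_tent_cis.
have -> : (fun t => \sum_p \sum_q c p q * (cR (tent t) * cis ((d q - d p) * t))) =
   (fun t : R => cR (tent t) *
      (mexp ((- (iC R * cR t)) *: Gth G th) *m G j
         *m mexp ((iC R * cR t) *: Gth G th)) a b).
  apply/funext => t.
  have -> : - (iC R * cR t) = iC R * cR (- t) by rewrite rmorphN mulrN.
  rewrite !mi GjE.
  rewrite !unitary_conjM//.
  rewrite [in RHS]mxE mulr_sumr exchange_big/=; apply: eq_bigr => q _.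
  rewrite [in RHS]mxE mulr_suml mulr_sumr; apply: eq_bigr => p _.
  rewrite mul_mx_diag mul_diag_mx !mxE /c !mxE.
  have -> : (d q - d p) * t = - t * d p + t * d q by ring.
  by rewrite -cisD; ring.
move=> ->; rewrite [in RHS]mxE exchange_big/=; apply: eq_bigr => q _.
rewrite [in RHS]mxE mulr_suml; apply: eq_bigr => p _.
by rewrite /c !mxE; ring.
Qed.

(** Here tanh ((x - y) / 2) = (e^x - e^y) / (e^x + e^y); when x = y both sides are 2 e^x. *)
Lemma divdiff_tent (x y : R) :
  2 * divdiff_exp x y = (expR x + expR y) * tent_ft (x - y).
Proof.
rewrite /divdiff_exp /tent_ft /coskernel; case: eqP => [->|/eqP xy].
  by rewrite subrr sinhc0 cosh0; field.
have w0 : x - y != 0 by rewrite subr_eq0.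
rewrite /sinhc (negbTE w0) /cosh opprB !expRB.
have := expR_gt0 x; have := expR_gt0 y; move: (expR x) (expR y) => u v v0 u0.
have uv : u * u + v * v + 2 * u * v != 0 by rewrite gt_eqF//; nra.
have xy2 : x - y != 0 := w0.
field.
rewrite xy2 !gt_eqF//; nra.
Qed.

Lemma lyapunov_rho : let X := - Phi G th (G j) + (\tr (G j *m rho G th))%:M in
  rho G th *m X + X *m rho G th = 2 *: pderiv (rho G) th j.
Proof.
move=> X.
pose r := dmx (fun k => cR (expR (- d k) / Z)).
pose tau := \sum_k g k k * cR (expR (- d k) / Z).
pose Y := - (\matrix_(p, q) (cR (tent_ft (d q - d p)) * g p q)) + tau%:M.
have XE : X = V *m Y *m ctr V.
  rewrite /X PhiE rhoE {1}GjE /Y mulmxDr mulmxDl mulmxN mulNmx; congr (_ + _).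
  rewrite mul_mx_scalar -scalemxAl Vu scalemx1; congr (_ %:M).
  rewrite unitary_conjM// trace_conj// /mxtrace /tau; apply: eq_bigr => k _.
  by rewrite mul_mx_diag !mxE.
rewrite XE rhoE pderiv_rho -/r.
rewrite !unitary_conjM// -mulmxDl -mulmxDr scalemxAl scalemxAr; congr (_ *m _ *m _).
apply/matrixP => p q.
have n0 : (0 < n)%N by apply: leq_ltn_trans (ltn_ord p).
have Z0 := Z_gt0 n0.
have cZ0 : cR Z != 0 :> R[i] by rewrite fmorph_eq0 gt_eqF.
(* Diagonal divided differences are plain exponentials, so the normalization adds [tau] times [rho]
   to the derivative; the scalar term of [X] accounts for twice that in the anticommutator. *)
have trD : \tr dmexp = - (cR Z * tau).
  rewrite /mxtrace /tau mulr_sumr -sumrN; apply: eq_bigr => k _.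
  rewrite mxE /divdiff_exp eqxx rmorphM/= fmorphV; field.
  exact: cZ0.
have rl (W : 'M[R[i]]_n) : (r *m W + W *m r) p q =
    cR (expR (- d p) / Z) * W p q + W p q * cR (expR (- d q) / Z).
  by rewrite /r mul_diag_mx mul_mx_diag !mxE.
have YE (g' : 'M[R[i]]_n) (c : R[i]) :
    (- (\matrix_(p, q) (cR (tent_ft (d q - d p)) * g' p q)) + c%:M) p q =
    - (cR (tent_ft (d q - d p)) * g' p q) + c *+ (p == q).
  by rewrite !mxE.
have DE (D : 'M[R[i]]_n) (c : R[i]) : (2 *: ((cR Z)^-1 *: (D - c *: r))) p q =
    2 * ((cR Z)^-1 * (D p q - c * (cR (expR (- d p) / Z) *+ (p == q)))).
  by rewrite !mxE.
rewrite rl /Y YE /drho DE trD [dmexp p q]mxE.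
have key : cR (expR (- d p) / Z + expR (- d q) / Z) * cR (tent_ft (d q - d p)) =
   2 * (cR Z)^-1 * cR (divdiff_exp (- d p) (- d q)).
  have -> : 2 * (cR Z)^-1 * cR (divdiff_exp (- d p) (- d q)) =
    (cR Z)^-1 * cR (2 * divdiff_exp (- d p) (- d q)).
    by rewrite rmorphM/= rmorph_nat; ring.
  rewrite divdiff_tent -fmorphV -!rmorphM; congr cR.
  have -> : - d p - - d q = d q - d p by ring.
  by field; rewrite gt_eqF.
apply: lyapunov_entry cZ0 _ _; last by move=> /eqP ->.
by rewrite -rmorphD.
Qed.

End QuantumState.

Theorem theorem3 (R : realType) (n J : nat) (G : 'I_J -> 'M[R[i]]_n)
    (hG : forall j, is_herm (G j))
    (th : 'I_J -> R) (j : 'I_J)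
    (U : 'M[R[i]]_n) (lam : 'I_n -> R)
    (horth : forall k l : 'I_n, bra U k *m ket U l = ((k == l)%:R)%:M)
    (hdec : rho G th = \sum_(k < n) cR (lam k) *: (ket U k *m bra U k)) :
  SLD U lam (pderiv (rho G) th j)
    = - Phi G th (G j) + (\tr (G j *m rho G th))%:M.
Proof.
(* [V] is chosen independently of [U]; it serves to prove the Lyapunov equation and the positivity
   of [lam]. *)
have [V [d [uV GV]]] := herm_spectral _ _ _ (Gth_herm _ _ _ _ hG th).
apply: (SLD_lyapunov _ _ _ _ _ _ _ horth hdec); last exact: (lyapunov_rho _ _ _ _ hG _ _ _ _ uV GV).
move=> k; apply: (eigenvalue_gt0 _ _ _ _ _ _ _ horth hdec uV _ (rhoE _ _ _ _ _ _ _ uV GV)) => l.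
by rewrite divr_gt0 ?expR_gt0// sum_expR_gt0// (leq_ltn_trans _ (ltn_ord k)).
Qed.
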